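(* Let $R$ be a Gorenstein quasi-fiber product ring with respect to the regular sequence $\underline x=x_1,\ldots,x_n$. Let $M$ and $N$ be nonzero finitely generated $R$-modules. Assume $N$ is a rigid-test module and, for some integer $t>n$, $\operatorname{Ext}^i_R(M,N)=0$ whenever $t\le i\le t+n$. Then $\operatorname{pd}_R M<\infty$ or $R$ is regular.
   Context: All local rings are commutative and Noetherian, and all modules are finitely generated; $\operatorname{pd}$ denotes projective dimension. A local ring $(R,\mathfrak m,k)$ is a fiber product ring if $R\cong S\times_k T=\{(s,t)\in S\times T : \pi_S(s)=\pi_T(t)\}$, where $S,T$ are local rings with the same residue field $k$, neither of them equal to $k$, and $\pi_S,\pi_T$ are the reductions modulo the maximal ideals. Equivalently, $\mathfrak m=I\oplus J$ for nonzero ideals $I,J$ of $R$. A local ring $R$ is a quasi-fiber product ring with respect to $\underline x=x_1,\dots,x_n$ ($n\ge 0$) if $\underline x$ is an $R$-regular sequence such that $R/(\underline x)$ is a fiber product ring. An $R$-module $N$ is a rigid-test module if for all $R$-modules $Z$: $\operatorname{Tor}^R_j(Z,N)=0$ for some $j\ge 1$ implies $\operatorname{Tor}^R_{j+1}(Z,N)=0$ and $\operatorname{pd}_R Z<\infty$. *)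

(* Defs.v *)
From HB Require Import structures.
From mathcomp Require Import all_boot all_order all_algebra.

Set Implicit Arguments.
Unset Strict Implicit.
Unset Printing Implicit Defensive.

Import GRing.Theory.
Local Open Scope ring_scope.

Definition surj (A B : Type) (f : A -> B) : Prop := forall b, exists a, f a = b.

(* An ideal of R is a submodule of the regular module R^o, so in_span also
   says that an element lies in the ideal generated by a sequence. *)
Definition in_span (R : comNzRingType) (V : lmodType R) (s : seq V) (v : V) : Prop :=
  exists c : 'I_(size s) -> R, v = \sum_(i < size s) c i *: s`_i.

Definition finitely_generated (R : comNzRingType) (V : lmodType R) : Prop :=
  exists s : seq V, forall v, in_span s v.

Definition nonzero_module (R : comNzRingType) (V : lmodType R) : Prop :=
  exists v : V, v != 0.

Section LocalRings.
Variable R : comNzRingType.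

Definition noetherian : Prop :=
  forall I : {pred R^o}, submod_closed I ->
    exists s : seq R^o, forall a, a \in I <-> in_span s a.

(* The elements of idealr R are the proper ideals of R.  Ideals are boolean
   predicates: classically these are all the ideals. *)
Definition maximal_ideal (m : idealr R) : Prop :=
  forall I : idealr R, (forall a, a \in m -> a \in I) -> forall a, a \in I -> a \in m.

Definition local_ring : Prop :=
  noetherian /\
  exists m : idealr R, maximal_ideal m /\
    forall m' : idealr R, maximal_ideal m' -> m' =i m.

Definition prime_chain (d : nat) : Prop :=
  exists p : nat -> prime_idealr R, forall i, (i < d)%N ->
    (forall a, a \in p i -> a \in p i.+1) /\
    exists2 a, a \in p i.+1 & a \notin p i.

Definition krull_dim (d : nat) : Prop := prime_chain d /\ ~ prime_chain d.+1.

Definition regular_ring : Prop :=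
  local_ring /\
  exists (m : idealr R) (s : seq R^o),
    [/\ maximal_ideal m, forall a, a \in m <-> in_span s a & krull_dim (size s)].

Definition regular_sequence (s : seq R^o) : Prop :=
  ~ in_span s 1 /\
  forall i, (i < size s)%N ->
    forall a : R, in_span (take i s) ((s`_i : R) * a : R^o) -> in_span (take i s) a.

End LocalRings.

Section FiberProduct.
Variables (S T k : comNzRingType) (pS : {rmorphism S -> k}) (pT : {rmorphism T -> k}).

Definition fprod_pred : {pred S * T} := fun u => pS u.1 == pT u.2.

Fact fprod_subring_closed : subring_closed fprod_pred.
Proof.
split=> [|u v|u v]; rewrite !unfold_in /= ?rmorph1 //.
  by move=> /eqP eu /eqP ev; rewrite !rmorphB eu ev.
by move=> /eqP eu /eqP ev; rewrite !rmorphM eu ev.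
Qed.

HB.instance Definition _ :=
  GRing.isSubringClosed.Build (S * T)%type fprod_pred fprod_subring_closed.

Record fprod := FProd { fprod_val : S * T; _ : fprod_val \in fprod_pred }.

HB.instance Definition _ := [isSub for fprod_val].
HB.instance Definition _ := [Choice of fprod by <:].
HB.instance Definition _ := [SubChoice_isSubComNzRing of fprod by <:].

End FiberProduct.

(* A surjective morphism from a local ring onto a field k is the reduction
   modulo the maximal ideal, with k as residue field; it is injective exactly
   when the local ring is k itself. *)
Definition fiber_product_ring (A : comNzRingType) : Prop :=
  local_ring A /\
  exists (S T : comNzRingType) (k : fieldType)
         (pS : {rmorphism S -> k}) (pT : {rmorphism T -> k}),
    [/\ local_ring S /\ local_ring T,
        surj pS /\ surj pT,
        ~ injective pS /\ ~ injective pT &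
        exists f : {rmorphism A -> fprod pS pT}, bijective f].

Definition quasi_fiber_product_ring (R : comNzRingType) (s : seq R^o) : Prop :=
  [/\ local_ring R, regular_sequence s &
      exists I : idealr R, (forall a, a \in I <-> in_span s a) /\
        fiber_product_ring {ideal_quot I}].

Section Homological.
Variable R : comNzRingType.
Implicit Types A B C M N P U Z : lmodType R.

Definition projective P : Prop :=
  forall A B (f : {linear A -> B}) (g : {linear P -> B}), surj f ->
    exists h : {linear P -> A}, forall p, f (h p) = g p.

Definition injective_module U : Prop :=
  forall A B (f : {linear A -> B}) (g : {linear A -> U}), injective f ->
    exists h : {linear B -> U}, forall a, h (f a) = g a.

Definition exact A B C (f : {linear A -> B}) (g : {linear B -> C}) : Prop :=
  forall b, g b = 0 <-> exists a, f a = b.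

Record proj_resolution M := ProjResolution {
  pterm : nat -> lmodType R;
  pdiff : forall i, {linear pterm i.+1 -> pterm i};
  paug : {linear pterm 0%N -> M};
  pterm_projective : forall i, projective (pterm i);
  paug_surj : surj paug;
  paug_exact : exact (pdiff 0%N) paug;
  pdiff_exact : forall i, exact (pdiff i.+1) (pdiff i) }.

Record inj_resolution M := InjResolution {
  jterm : nat -> lmodType R;
  jdiff : forall i, {linear jterm i -> jterm i.+1};
  jaug : {linear M -> jterm 0%N};
  jterm_injective : forall i, injective_module (jterm i);
  jaug_inj : injective jaug;
  jaug_exact : exact jaug (jdiff 0%N);
  jdiff_exact : forall i, exact (jdiff i) (jdiff i.+1) }.

Definition finite_pd M : Prop :=
  exists (P : proj_resolution M) (d : nat),
    forall i, (d < i)%N -> forall p : pterm P i, p = 0.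

Definition finite_id M : Prop :=
  exists (J : inj_resolution M) (d : nat),
    forall i, (d < i)%N -> forall p : jterm J i, p = 0.

(* Ext^i(M, N) = 0, the i-th cohomology of Hom(P, N) being zero. *)
Definition Ext_zero (i : nat) M N : Prop :=
  exists P : proj_resolution M,
    forall f : {linear pterm P i -> N}, (forall p, f (pdiff P i p) = 0) ->
      match i return (pterm P i -> N) -> Prop with
      | 0 => fun f => forall p, f p = 0
      | j.+1 => fun f => exists g : {linear pterm P j -> N},
                           forall p, f p = g (pdiff P j p)
      end f.

(* The bilinear map b : M x N -> U exhibits U as the tensor product of M and N. *)
Definition is_tensor M N U (b : {bilinear M -> N -> U}) : Prop :=
  forall C (f : {bilinear M -> N -> C}),
    (exists g : {linear U -> C}, forall x y, g (b x y) = f x y) /\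
    (forall g h : {linear U -> C},
       (forall x y, g (b x y) = f x y) -> (forall x y, h (b x y) = f x y) -> g =1 h).

(* Tor_i(Z, N) = 0, the i-th homology of the complex with terms
   U j = pterm P j (x) N and differentials D j = pdiff P j (x) id being zero. *)
Definition Tor_zero (i : nat) Z N : Prop :=
  exists (P : proj_resolution Z) (U : nat -> lmodType R)
         (b : forall j, {bilinear pterm P j -> N -> U j})
         (D : forall j, {linear U j.+1 -> U j}),
    [/\ forall j, is_tensor (b j),
        forall j p y, D j (b j.+1 p y) = b j (pdiff P j p) y &
        match i with
        | 0 => surj (D 0%N)
        | j.+1 => exact (D j.+1) (D j)
        end].

Definition rigid_test N : Prop :=
  forall Z, finitely_generated Z ->
    forall j, (1 <= j)%N -> Tor_zero j Z N -> Tor_zero j.+1 Z N /\ finite_pd Z.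

End Homological.

Definition gorenstein (R : comNzRingType) : Prop :=
  local_ring R /\ finite_id (R^o : lmodType R).

(* Main.v *)
Require Import Defs.
From mathcomp Require Import all_boot all_order all_algebra.
From HB Require Import structures.
From mathcomp Require Import boolp.

(** The proof shows that pd M is finite.

    The ring R has injective dimension at most n + 1.  Fix an injective resolution
    J of R and compute Ext(V, R) as the cohomology of Hom(V, J), so that short
    exact sequences in V give long exact sequences by the injectivity of the terms
    of J.  Since R has finite injective dimension, one can show by descending
    induction on r that Ext^r(V, R) = 0 for all finitely generated V and all
    r >= n + 2 ([gorenstein_Ext_vanishes]).  Let A be the quotient of R by the
    regular sequence, so that Ext^r(A, R) = 0 for r > n ([Ext_cyclic_regular]).  As
    Ext^(r+1)(-, R) vanishes by induction, the property Ext^r(V, R) = 0 passes to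
    submodules of V ([Ext_vanishes_top]).
    - Ext^r vanishes on the residue field k ([Ext_cyclic_residue]).  If A has a
      nonzero socle then k embeds in A.  Otherwise write the maximal ideal of A as a
      direct sum of I and I'; the annihilator of I is I', so that A/I' embeds in a
      power of A, and likewise for A/I.  Then the exact sequence
      0 -> A -> A/I x A/I' -> k -> 0 gives the claim.
    - Ext^r vanishes on every R/I by Noetherian induction on I ([Ext_residue]).
      If I is proper and not maximal, take y in the maximal ideal and not in I.  If
      y is a zero divisor modulo I, then R/I is an extension of two cyclic modules
      with larger annihilators.
      If not, then y acts surjectively on Ext^r(R/I, R), because the next Ext
      vanishes on R/(I + yR), and Nakayama's lemma applies ([Ext_nakayama]).

    Let F be a resolution of M by finite free modules, and let X be the cokernel of
    the transpose of the differential from F_(t+1) to F_t, the Auslander transpose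
    of the t-th syzygy of M.  The vanishing of Ext^t(M, N) makes Tor_1(X, N) vanish,
    and N is a rigid-test module, so pd X is finite.  On the other hand t >= n + 1,
    hence the dual of F is exact above degree t; thus X embeds in a finite free
    module with a cokernel of the same kind, and so on, which gives Ext^i(X, R) = 0
    for all i > 0 ([Ext_vanishes_transpose]).  A finitely generated module of finite
    projective dimension with this property is projective: the differentials of a
    resolution G of X split in high degrees ([finite_pd_regular]), and the splitting
    descends along G because the dual of G is exact ([mx_regular_descent]).  So the
    first differential of G splits.  It is the transpose of the differential from
    F_(t+1) to F_t, which therefore splits as well; hence the t-th syzygy of M is
    projective and pd M is finite ([regular_finite_pd]). *)

Set Implicit Arguments.
Unset Strict Implicit.
Unset Printing Implicit Defensive.

Import GRing.Theory.
Local Open Scope ring_scope.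

(** * Linear maps and quotients *)

Section Modules.
Variable R : comNzRingType.
Implicit Types U V W : lmodType R.

(** The linear map with underlying function f. *)
Definition linmap U V (f : U -> V) (H : linear f) : {linear U -> V} :=
  HB.pack f (GRing.isLinear.Build R U V *:%R f H).

(** Submodules are predicates with values in Prop. *)
Definition submodule V (P : V -> Prop) : Prop :=
  P 0 /\ forall a u v, P u -> P v -> P (a *: u + v).

Lemma submoduleZ V (P : V -> Prop) a u : submodule P -> P u -> P (a *: u).
Proof. by case=> P0 PD Pu; rewrite -[_ *: _]addr0; apply: PD. Qed.

Lemma submoduleD V (P : V -> Prop) u v : submodule P -> P u -> P v -> P (u + v).
Proof. by case=> P0 PD Pu Pv; rewrite -[u]scale1r; apply: PD. Qed.

Lemma submoduleB V (P : V -> Prop) u v : submodule P -> P u -> P v -> P (u - v).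
Proof. by case=> P0 PD Pu Pv; rewrite addrC -scaleN1r; apply: PD. Qed.

Lemma submodule_sum V (P : V -> Prop) n (F : 'I_n -> V) :
  submodule P -> (forall i, P (F i)) -> P (\sum_i F i).
Proof.
move=> PS PF; elim/big_ind: _ => [|u v|i _]; [exact: PS.1 | exact: submoduleD | exact: PF].
Qed.

Lemma submodule_ker V W (f : {linear V -> W}) : submodule (fun v => f v = 0).
Proof.
by split=> [|a u v fu fv]; rewrite ?linear0 // linearP fu fv scaler0 addr0.
Qed.

Lemma submodule_img V W (f : {linear V -> W}) : submodule (fun w => exists v, f v = w).
Proof.
split=> [|a _ _ [u <-] [v <-]]; first by exists 0; rewrite linear0.
by exists (a *: u + v); rewrite linearP.
Qed.

Lemma submodule_span V (s : seq V) : submodule (in_span s).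
Proof.
split=> [|a _ _ [c ->] [d ->]].
  by exists (fun=> 0); rewrite big1 // => i _; rewrite scale0r.
exists (fun i => a * c i + d i); rewrite scaler_sumr -big_split /=.
by apply: eq_bigr => i _; rewrite scalerDl scalerA.
Qed.

Section Quotient.
Variables (V : lmodType R) (P : V -> Prop) (PS : submodule P).

Let Pb : V -> bool := fun v => `[< P v >].

Let Pb_closed : zmod_closed Pb.
Proof.
split=> [|u v]; first by apply/asboolP; case: PS.
rewrite !unfold_in /Pb; move=> /asboolP Pu /asboolP Pv; apply/asboolP; exact: submoduleB.
Qed.

Let I : zmodClosed V := HB.pack Pb (GRing.isZmodClosed.Build V Pb Pb_closed).
Let Q : zmodType := Quotient.quot I.
Let p (v : V) : Q := \pi_(Quotient.quot I)%qT v.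

Let pP u v : p u = p v <-> P (u - v).
Proof.
rewrite /p; split=> [e|Puv].
  by have /eqP := e; rewrite -Quotient.idealrBE unfold_in => /asboolP.
by apply/eqP; rewrite -Quotient.idealrBE unfold_in; apply/asboolP.
Qed.

Let p_repr (x : Q) : p (generic_quotient.repr x) = x.
Proof. exact: generic_quotient.reprK. Qed.

Let pD u v : p (u + v) = p u + p v.
Proof. exact: (raddfD (\pi_(Quotient.quot I)%qT)). Qed.

Let scale (a : R) (x : Q) : Q := p (a *: generic_quotient.repr x).

Let scaleE a v : scale a (p v) = p (a *: v).
Proof.
apply/pP; rewrite -scalerBr; apply: submoduleZ => //.
by apply/pP; rewrite p_repr.
Qed.

Let scaleA a b x : scale a (scale b x) = scale (a * b) x.
Proof. by rewrite -[x]p_repr !scaleE scalerA. Qed.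

Let scale1 x : scale 1 x = x.
Proof. by rewrite -[x]p_repr !scaleE scale1r. Qed.

Let scaleDr : right_distributive scale +%R.
Proof. by move=> a x y; rewrite -[x]p_repr -[y]p_repr -pD !scaleE -pD scalerDr. Qed.

Let scaleDl x : {morph scale^~ x : a b / a + b}.
Proof. by move=> a b; rewrite -[x]p_repr !scaleE -pD scalerDl. Qed.

Let Qmod : lmodType R := HB.pack Q
  (GRing.Zmodule_isLmodule.Build R Q scaleA scale1 scaleDr scaleDl).

Lemma quotient_exists : exists (W : lmodType R) (q : {linear V -> W}),
  surj q /\ forall v, q v = 0 <-> P v.
Proof.
have pl : linear (p : V -> Qmod) by move=> a u v; rewrite pD -scaleE.
exists Qmod, (linmap pl); split=> [x|v]; first by exists (generic_quotient.repr x); exact: p_repr.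
have p0 : p 0 = 0 by exact: (raddf0 (\pi_(Quotient.quot I)%qT)).
by rewrite -[v in P v]subr0 -pP p0.
Qed.

End Quotient.

Lemma factor_surj U V W (q : {linear U -> V}) (f : {linear U -> W}) :
  surj q -> (forall u, q u = 0 -> f u = 0) ->
  exists h : {linear V -> W}, forall u, h (q u) = f u.
Proof.
move=> qs qf; have /choice [s qK] := qs.
have qfE u u' : q u = q u' -> f u = f u'.
  by move=> e; apply/eqP; rewrite -subr_eq0 -linearB; apply/eqP/qf; rewrite linearB e subrr.
have hl : linear (fun v => f (s v)).
  by move=> a v w; rewrite -linearP; apply: qfE; rewrite linearP !qK.
by exists (linmap hl) => u; apply: qfE; rewrite qK.
Qed.

Lemma factor_inj U V W (i : {linear V -> W}) (f : {linear U -> W}) :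
  injective i -> (forall u, exists v, i v = f u) ->
  exists h : {linear U -> V}, forall u, i (h u) = f u.
Proof.
move=> ii fi.
have /choice [h iK] := fi.
have hl : linear h.
  by move=> a u v; apply: ii; rewrite linearP !iK linearP.
by exists (linmap hl).
Qed.

Lemma image_exists V W (f : {linear V -> W}) :
  exists (K : lmodType R) (q : {linear V -> K}) (i : {linear K -> W}),
  [/\ surj q, injective i & forall v, i (q v) = f v].
Proof.
have [K [q [qs qk]]] := quotient_exists (submodule_ker f).
have [|i iq] := @factor_surj V K W q f qs; first by move=> u /qk.
exists K, q, i; split=> // x y.
have [u <-] := qs x; have [v <-] := qs y; rewrite !iq => e.
apply/eqP; rewrite -subr_eq0 -linearB; apply/eqP/qk.
by rewrite linearB e subrr.
Qed.

(** Free modules are projective relative to any map whose image contains the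
    image of the map to be lifted. *)
Lemma rV_lift n V W (f : {linear V -> W}) (g : {linear 'rV[R]_n -> W}) :
  (forall p, exists v, f v = g p) ->
  exists h : {linear 'rV[R]_n -> V}, forall p, f (h p) = g p.
Proof.
move=> fg.
have /choice [b fb] i := fg (delta_mx 0 i).
have hl : linear (fun p : 'rV[R]_n => \sum_i p 0 i *: b i).
  move=> a p q; rewrite scaler_sumr -big_split /=; apply: eq_bigr => i _.
  by rewrite !mxE scalerDl scalerA.
exists (linmap hl) => p /=; rewrite linear_sum [in RHS](row_sum_delta p) linear_sum.
by apply: eq_bigr => i _; rewrite !linearZ /= fb.
Qed.

Lemma rV_projective n : projective 'rV[R]_n.
Proof. by move=> A B f g fs; apply: rV_lift => p; apply: fs. Qed.

Lemma regular_lift V W (f : {linear V -> W}) (g : {linear R^o -> W}) :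
  (exists v, f v = g (1 : R)) ->
  exists h : {linear R^o -> V}, forall p, f (h p) = g p.
Proof.
move=> [v e].
have hl : linear (fun a : R^o => (a : R) *: v).
  by move=> a p q; rewrite scalerDl scalerA.
exists (linmap hl) => p /=.
by rewrite linearZ /= e -linearZ /=; congr (g _); exact: mulr1.
Qed.

(** Every map between finite free modules acts on row vectors by right
    multiplication by a matrix. *)
Lemma rV_linear_mx m n (f : {linear 'rV[R]_m -> 'rV[R]_n}) :
  exists A : 'M[R]_(m, n), forall v, f v = v *m A.
Proof. by exists (lin1_mx f) => v; rewrite mul_rV_lin1. Qed.

Lemma rV_linear_col m (f : {linear 'rV[R]_m -> R^o}) :
  exists u : 'cV[R]_m, forall v, f v = (v *m u) 0 0.
Proof.
exists (\col_i f (delta_mx 0 i)) => v.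
rewrite [in LHS](row_sum_delta v) linear_sum mxE; apply: eq_bigr => i _.
by rewrite linearZ /= mxE.
Qed.

(** The linear form v |-> v u. *)
Definition col_map m (u : 'cV[R]_m) : {linear 'rV[R]_m -> R^o}.
Proof.
apply: (@linmap _ _ (fun v : 'rV[R]_m => (v *m u) 0 0 : R^o)).
by move=> a v w; rewrite mulmxDl -scalemxAl !mxE.
Defined.

Lemma row_eq0 m n (A : 'M[R]_(m, n)) : (forall v : 'rV_m, v *m A = 0) -> A = 0.
Proof.
by move=> A0; apply/row_matrixP => i; rewrite rowE A0 row0.
Qed.

End Modules.

(** * Ext computed from an injective resolution *)

Section InjectiveExt.
Variables (R : comNzRingType) (U : lmodType R) (J : inj_resolution U).
Implicit Types (V W : lmodType R) (e : nat).

Local Notation d := (jdiff J).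

Definition cocycle e V (f : {linear V -> jterm J e}) : Prop := forall v, d e (f v) = 0.

(** [Ext_vanishes e V] says that Ext^(e+1)(V, U) = 0, computed as the cohomology
    of Hom(V, J) at J_(e+1). *)
Definition Ext_vanishes e V : Prop :=
  forall f : {linear V -> jterm J e.+1}, cocycle f ->
    exists g : {linear V -> jterm J e}, forall v, f v = d e (g v).

(** [Ext_divisible y e V] says that Ext^(e+1)(V, U) = y Ext^(e+1)(V, U). *)
Definition Ext_divisible (y : R) e V : Prop :=
  forall f : {linear V -> jterm J e.+1}, cocycle f ->
    exists (f' : {linear V -> jterm J e.+1}) (g : {linear V -> jterm J e}),
      cocycle f' /\ forall v, f v = y *: f' v + d e (g v).

(** Short exact sequences 0 -> V' -> V -> V'' -> 0. *)
Definition ses V' V V'' (i : {linear V' -> V}) (p : {linear V -> V''}) : Prop :=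
  [/\ injective i, surj p & exact i p].

Lemma ses0 V' V V'' (i : {linear V' -> V}) (p : {linear V -> V''}) v :
  ses i p -> p (i v) = 0.
Proof. by case=> _ _ ex; apply/ex; exists v. Qed.

Lemma jdiff_comp e (x : jterm J e) : d e.+1 (d e x) = 0.
Proof. by apply/(@jdiff_exact _ _ J e _); exists x. Qed.

Lemma Ext_vanishes_div e V : Ext_vanishes e V -> forall y, Ext_divisible y e V.
Proof.
move=> van y f /van [g fg]; exists \0, g.
by split=> v; [exact: linear0 | rewrite scaler0 add0r].
Qed.

Lemma jterm_extend V W e (i : {linear V -> W}) (f : {linear V -> jterm J e}) :
  injective i -> exists h : {linear W -> jterm J e}, forall v, h (i v) = f v.
Proof. exact: jterm_injective. Qed.

Lemma ses_factor V' V V'' W (i : {linear V' -> V}) (p : {linear V -> V''})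
    (f : {linear V -> W}) :
  ses i p -> (forall v, f (i v) = 0) ->
  exists h : {linear V'' -> W}, forall v, h (p v) = f v.
Proof.
by move=> [_ ps ex] fi; apply: factor_surj => // v /ex [w <-].
Qed.

Lemma ses_cocycle V' V V'' e (i : {linear V' -> V}) (p : {linear V -> V''})
    (f : {linear V -> jterm J e}) (h : {linear V'' -> jterm J e}) :
  ses i p -> (forall v, h (p v) = f v) -> cocycle f -> cocycle h.
Proof. by move=> [_ ps _] hf fc w; have [v <-] := ps w; rewrite hf. Qed.

Section LongExactSequence.
Variables (V' V V'' : lmodType R) (i : {linear V' -> V}) (p : {linear V -> V''}).
Hypothesis ip : ses i p.

Lemma Ext_vanishes_mid e :
  Ext_vanishes e V' -> Ext_vanishes e V'' -> Ext_vanishes e V.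
Proof.
move=> van' van'' f fc; have [ii _ _] := ip.
have [|g' fg'] := van' (f \o i : {linear V' -> _}); first by move=> v; apply: fc.
have [g gi] := jterm_extend g' ii.
have [|h hp] := @ses_factor _ _ _ _ _ _ (f \- (d e \o g) : {linear V -> _}) ip.
  by move=> v; have /= := fg' v; rewrite gi => ->; rewrite subrr.
have [|k hk] := van'' h.
  by apply: (ses_cocycle ip hp) => v; rewrite /= linearB /= jdiff_comp fc subrr.
exists (g \+ (k \o p) : {linear V -> _}) => v.
by rewrite linearD /= -hk hp /= addrC subrK.
Qed.

Lemma Ext_vanishes_sub e :
  Ext_vanishes e V -> Ext_vanishes e.+1 V'' -> Ext_vanishes e V'.
Proof.
move=> van van'' f fc; have [ii _ _] := ip.
have [g gi] := jterm_extend f ii.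
have [|h hp] := @ses_factor _ _ _ _ _ _ (d e.+1 \o g : {linear V -> _}) ip.
  by move=> v; rewrite /= gi.
have [|k hk] := van'' h; first by apply: (ses_cocycle ip hp) => v; rewrite /= jdiff_comp.
have [|l gl] := van (g \- (k \o p) : {linear V -> _}).
  by move=> v; rewrite /= linearB /= -hk hp subrr.
exists (l \o i : {linear V' -> _}) => v.
by rewrite /= -gl /= (ses0 _ ip) linear0 subr0.
Qed.

Lemma Ext_vanishes_quo e :
  Ext_vanishes e V' -> Ext_vanishes e.+1 V -> Ext_vanishes e.+1 V''.
Proof.
move=> van' van f fc; have [ii ps _] := ip.
have [|g fg] := van (f \o p : {linear V -> _}); first by move=> v; apply: fc.
have [|h' gh'] := van' (g \o i : {linear V' -> _}).
  by move=> v; rewrite /= -fg /= (ses0 _ ip) linear0.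
have [h hi] := jterm_extend h' ii.
have [|k kp] := @ses_factor _ _ _ _ _ _ (g \- (d e \o h) : {linear V -> _}) ip.
  by move=> v; have /= := gh' v; rewrite hi => ->; rewrite subrr.
exists k => w; have [v <-] := ps w.
by rewrite kp /= linearB /= jdiff_comp subr0 -fg.
Qed.

(** Dimension shift: V plays the role of a free module and V' that of the syzygy
    of V''. *)
Lemma Ext_divisible_quo (y : R) e : Ext_vanishes e V ->
  Ext_divisible y e.+1 V'' -> Ext_vanishes e.+1 V -> Ext_divisible y e V'.
Proof.
move=> van dv'' van1 f fc; have [ii _ _] := ip.
have [g gi] := jterm_extend f ii.
have [|h hp] := @ses_factor _ _ _ _ _ _ (d e.+1 \o g : {linear V -> _}) ip.
  by move=> v; rewrite /= gi.
have [|h' [k [h'c hk]]] := dv'' h.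
  by apply: (ses_cocycle ip hp) => v; rewrite /= jdiff_comp.
have [|u h'u] := van1 (h' \o p : {linear V -> _}); first by move=> v; apply: h'c.
have [|l gl] := van (g \- (y \*: u) \- (k \o p) : {linear V -> _}).
  move=> v; rewrite /= !linearB linearZ /= -h'u /=.
  have /= := hp v; rewrite hk => <-.
  by rewrite -addrA -opprD subrr.
exists (u \o i : {linear V' -> _}), (l \o i : {linear V' -> _}); split=> v.
  by rewrite /= -h'u /= (ses0 _ ip) linear0.
by rewrite /= -gl /= (ses0 _ ip) linear0 subr0 gi addrC subrK.
Qed.

(** In the lowest degree, divisibility of Ext^1(V'', U) says that, modulo the maps
    that extend to V, every map from V' to U is a multiple of y. *)
Lemma Ext_divisible_base (y : R) : Ext_vanishes 0 V -> Ext_divisible y 0 V'' ->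
  forall f : {linear V' -> U}, exists (f' : {linear V' -> U}) (g : {linear V -> U}),
    forall v, f v = y *: f' v + g (i v).
Proof.
move=> van dv'' f; have [ii _ _] := ip.
have aug0 x : d 0%N (jaug J x) = 0 by apply/(@jaug_exact _ _ J _); exists x.
have aug_lift W (h : {linear W -> jterm J 0}) : cocycle h ->
    exists h' : {linear W -> U}, forall w, jaug J (h' w) = h w.
  move=> hc; apply: (@factor_inj _ _ _ _ (jaug J) h (@jaug_inj _ _ J)).
  by move=> w; apply/(@jaug_exact _ _ J _).
have [g gi] := jterm_extend (jaug J \o f : {linear V' -> _}) ii.
have [|h hp] := @ses_factor _ _ _ _ _ _ (d 0%N \o g : {linear V -> _}) ip.
  by move=> v; rewrite /= gi /= aug0.
have [|h' [k [h'c hk]]] := dv'' h.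
  by apply: (ses_cocycle ip hp) => v; rewrite /= jdiff_comp.
have [|u h'u] := van (h' \o p : {linear V -> _}); first by move=> v; apply: h'c.
have [|l gl] := aug_lift _ (g \- (y \*: u) \- (k \o p) : {linear V -> _}).
  move=> v; rewrite /= !linearB linearZ /= -h'u /=.
  have /= := hp v; rewrite hk => <-.
  by rewrite -addrA -opprD subrr.
have [|f' f'u] := aug_lift _ (u \o i : {linear V' -> _}).
  by move=> v; rewrite /= -h'u /= (ses0 _ ip) linear0.
exists f', l => v; apply: (@jaug_inj _ _ J); rewrite linearD linearZ /= f'u gl /=.
by rewrite gi (ses0 _ ip) linear0 subr0 addrC subrK.
Qed.

Lemma Ext_vanishes_base : Ext_vanishes 0 V ->
  (forall f : {linear V' -> U}, exists g : {linear V -> U}, forall v, f v = g (i v)) ->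
  Ext_vanishes 0 V''.
Proof.
move=> van ext f fc; have [ii ps _] := ip.
have [|g fg] := van (f \o p : {linear V -> _}); first by move=> v; apply: fc.
have [|h' gh'] := @factor_inj _ _ _ _ (jaug J) (g \o i : {linear V' -> _}) (@jaug_inj _ _ J).
  by move=> v; apply/(@jaug_exact _ _ J _); rewrite /= -fg /= (ses0 _ ip) linear0.
have [h hi] := ext h'.
have [|k kp] := @ses_factor _ _ _ _ _ _ (g \- (jaug J \o h) : {linear V -> _}) ip.
  by move=> v; have /= := gh' v; rewrite hi => ->; rewrite subrr.
have aug0 x : d 0%N (jaug J x) = 0 by apply/(@jaug_exact _ _ J _); exists x.
exists k => w; have [v <-] := ps w.
by rewrite kp /= linearB /= aug0 subr0 -fg.
Qed.

End LongExactSequence.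

(** If y is a nonzerodivisor on V and the next Ext of V / yV vanishes, then y
    acts surjectively on Ext of V. *)
Lemma Ext_divisible_scale (y : R) e V V'' (i : {linear V -> V}) (p : {linear V -> V''}) :
  ses i p -> (forall v, i v = y *: v) ->
  Ext_vanishes e.+1 V'' -> Ext_divisible y e V.
Proof.
move=> ip iy van'' f fc; have [ii _ _] := ip.
have [g gi] := jterm_extend f ii.
have [|h hp] := @ses_factor _ _ _ _ _ _ (d e.+1 \o g : {linear V -> _}) ip.
  by move=> v; rewrite /= gi.
have [|k hk] := van'' h; first by apply: (ses_cocycle ip hp) => v; rewrite /= jdiff_comp.
exists (g \- (k \o p) : {linear V -> _}), \0; split=> v.
  by rewrite /= linearB /= -hk hp subrr.
by rewrite linear0 addr0 /= scalerBr -!linearZ /= -iy gi (ses0 _ ip) linear0 subr0.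
Qed.

Lemma Ext_vanishes_rV e n : Ext_vanishes e 'rV[R]_n.
Proof.
move=> f fc; have [|g fg] := @rV_lift R n _ _ (d e) f; last by exists g => v.
by move=> v; apply/(@jdiff_exact _ _ J e _).
Qed.

Lemma Ext_vanishes_regular e : Ext_vanishes e R^o.
Proof.
move=> f fc; have [|g fg] := @regular_lift R _ _ (d e) f; last by exists g => v.
by apply/(@jdiff_exact _ _ J e _).
Qed.

Lemma Ext_vanishes_prod e V W :
  Ext_vanishes e V -> Ext_vanishes e W -> Ext_vanishes e (V * W)%type.
Proof.
have il : linear (fun v : V => (v, 0 : W)).
  by move=> a u v; congr (_, _); rewrite /= scaler0 addr0.
have pl : linear (fun u : V * W => u.2) by [].
apply: (@Ext_vanishes_mid _ _ _ (linmap il) (linmap pl)); split.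
- by move=> u v [].
- by move=> w; exists (0, w).
- move=> [v w]; split=> [/= ->|[u [_ <-]]] //; by exists v.
Qed.

(** Vanishing of Ext does not depend on the model of a quotient of V. *)
Lemma Ext_vanishes_iso e V W W' (q : {linear V -> W}) (q' : {linear V -> W'}) :
  surj q -> surj q' -> (forall v, q v = 0 <-> q' v = 0) ->
  Ext_vanishes e W -> Ext_vanishes e W'.
Proof.
move=> qs qs' qq' van f fc.
have [|f0 f0q] := @factor_surj _ _ _ _ q (f \o q' : {linear V -> _}) qs.
  by move=> v /qq' /= ->; rewrite linear0.
have [|g f0g] := van f0.
  by move=> w; have [v <-] := qs w; rewrite f0q; apply: fc.
have [|g' g'q] := @factor_surj _ _ _ _ q' (g \o q : {linear V -> _}) qs'.
  by move=> v /qq' /= ->; rewrite linear0.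
by exists g' => w; have [v <-] := qs' w; rewrite g'q /= -f0g f0q.
Qed.

Lemma Ext_vanishes0 e V : (forall v : V, v = 0) -> Ext_vanishes e V.
Proof. by move=> V0 f fc; exists \0 => v; rewrite (V0 v) !linear0. Qed.

End InjectiveExt.

(** * Noetherian rings and resolutions by finite free modules *)

Section Noetherian.
Variable R : comNzRingType.
Implicit Types V W : lmodType R.

Lemma span_sub V (P : V -> Prop) (s : seq V) v :
  submodule P -> (forall u, u \in s -> P u) -> in_span s v -> P v.
Proof.
move=> PS Ps [c ->]; apply: submodule_sum => // i.
by apply: submoduleZ => //; apply/Ps/mem_nth.
Qed.

Lemma mem_span V (s : seq V) v : v \in s -> in_span s v.
Proof.
move=> /(nthP 0) [i lti <-]; exists (fun j => (val j == i)%:R).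
rewrite (bigD1 (Ordinal lti)) //= eqxx scale1r big1 ?addr0 // => j ne.
case: eqP => [e|_]; last by rewrite scale0r.
by case/eqP: ne; apply: val_inj.
Qed.

Lemma ideal_fg (I : R^o -> Prop) : noetherian R -> submodule I ->
  exists s : seq R^o, forall a, I a <-> in_span s a.
Proof.
move=> noeth [I0 ID].
have [|s sP] := noeth (fun a => `[< I a >]).
  split=> [|a u v /asboolP Iu /asboolP Iv]; first exact/asboolP.
  by apply/asboolP/ID.
by exists s => a; rewrite -sP; split=> /asboolP.
Qed.

Lemma noetherian_rV n (P : 'rV[R]_n -> Prop) : noetherian R -> submodule P ->
  exists s : seq 'rV[R]_n, forall v, P v <-> in_span s v.
Proof.
move=> noeth PS.
(* Descending induction on the number k of leading coordinates required to vanish. *)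
pose Pk k v := P v /\ forall i : 'I_n, (i < k)%N -> v 0 i = 0.
have PkS k : submodule (Pk k).
  split=> [|a u v [Pu u0] [Pv v0]].
    by split; [case: PS | move=> i _; rewrite mxE].
  split; first by case: PS => _; apply.
  by move=> i ltik; rewrite !mxE u0 // v0 // mulr0 addr0.
have gen j : (j <= n)%N -> exists s : seq 'rV[R]_n, forall v, Pk (n - j)%N v <-> in_span s v.
  elim: j => [_|j IH ltjn].
    exists [::] => v; split=> [[Pv v0]|].
      exists (fun=> 0); rewrite big_ord0; apply/rowP => i.
      by rewrite mxE v0 // subn0.
    by move=> [c ->]; rewrite big_ord0; case: (PkS (n - 0)%N).
  have [s sP] := IH (ltnW ltjn).
  have ltkn : (n - j.+1 < n)%N by rewrite ltn_subrL /= (leq_trans _ ltjn).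
  pose k : 'I_n := Ordinal ltkn.
  have kS : (n - j)%N = k.+1 by rewrite /= subnSK.
  have [|t tP] := @ideal_fg (fun a => exists v, Pk k v /\ v 0 k = a) noeth.
    split=> [|a _ _ [u [Pu <-]] [v [Pv <-]]].
      by exists 0; rewrite mxE; split=> //; case: (PkS k).
    exists (a *: u + v); rewrite !mxE; split=> //.
    by case: (PkS k) => _; apply.
  have /choice [l lP] (a : R^o) : exists v, a \in t -> Pk k v /\ v 0 k = a.
    case: (boolP (a \in t)) => [|_]; last by exists 0.
    by move=> /mem_span /tP [v Pv]; exists v.
  exists (s ++ [seq l a | a <- t]) => v; split; last first.
    apply: span_sub (PkS k) _ => u; rewrite mem_cat => /orP [/mem_span /sP|].
      rewrite kS => -[Pu u0]; split=> // i ltik; apply: u0; exact: ltnW.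
    by move=> /mapP [a /lP [Pa _] ->].
  move=> Pv.
  have /tP [c vk] : exists u, Pk k u /\ u 0 k = v 0 k by exists v.
  pose w := \sum_(i < size t) c i *: l t`_i.
  have wk : w 0 k = v 0 k.
    rewrite vk summxE; apply: eq_bigr => i _; rewrite mxE.
    by have [_ ->] := lP _ (mem_nth 0 (ltn_ord i)).
  have Pw : Pk k w.
    apply: (submodule_sum (PkS k)) => i; apply: (submoduleZ _ (PkS k)).
    by have [] := lP _ (mem_nth 0 (ltn_ord i)).
  rewrite -[v](subrK w); apply: submoduleD; first exact: submodule_span.
    apply: span_sub (submodule_span _) (_ : forall u, u \in s -> _) _.
      by move=> u us; apply: mem_span; rewrite mem_cat us.
    apply/sP; rewrite kS; have [Pvw vw0] := submoduleB (PkS k) Pv Pw.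
    split=> // i; rewrite ltnS leq_eqVlt => /orP [/eqP ik|]; last exact: vw0.
    by rewrite (val_inj ik : i = k) !mxE wk subrr.
  apply: (submodule_sum (submodule_span _)) => i.
  apply: (submoduleZ _ (submodule_span _)); apply: mem_span.
  by rewrite mem_cat map_f ?orbT // mem_nth.
have [s sP] := gen n (leqnn n); exists s => v; rewrite -sP subnn.
by split=> [Pv|[]] //; split.
Qed.

Lemma span_rV n (s : seq 'rV[R]_n) v :
  in_span s v <-> exists w : 'rV_(size s), v = w *m \matrix_i s`_i.
Proof.
split=> [[c ->]|[w ->]].
  exists (\row_i c i); rewrite mulmx_sum_row; apply: eq_bigr => i _.
  by rewrite rowK mxE.
exists (fun i => w 0 i); rewrite mulmx_sum_row; apply: eq_bigr => i _.
by rewrite rowK.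
Qed.

Lemma submodule_rows n (P : 'rV[R]_n -> Prop) : noetherian R -> submodule P ->
  exists m (B : 'M[R]_(m, n)), forall v, P v <-> exists w, v = w *m B.
Proof.
move=> noeth PS; have [s sP] := noetherian_rV noeth PS.
by exists (size s), (\matrix_i s`_i) => v; rewrite sP span_rV.
Qed.

Lemma fg_rV n : finitely_generated 'rV[R]_n.
Proof.
exists [seq delta_mx 0 i | i <- enum 'I_n] => v.
rewrite [v]row_sum_delta; apply: (submodule_sum (submodule_span _)) => i.
apply: (submoduleZ _ (submodule_span _)); apply: mem_span.
by rewrite map_f // mem_enum.
Qed.

Lemma span_map V W (f : {linear V -> W}) s v :
  in_span s v -> in_span [seq f u | u <- s] (f v).
Proof.
apply: (@span_sub _ (fun v => in_span [seq f u | u <- s] (f v))) => [|u us].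
  split=> [|a u u' fu fu']; first by rewrite linear0; case: (submodule_span [seq f u | u <- s]).
  by rewrite linearP; case: (submodule_span [seq f u | u <- s]) => _; apply.
exact/mem_span/map_f.
Qed.

Lemma fg_surj V W (q : {linear V -> W}) :
  surj q -> finitely_generated V -> finitely_generated W.
Proof.
move=> qs [s sP]; exists [seq q v | v <- s] => w; have [v <-] := qs w.
exact/span_map/sP.
Qed.

Lemma fg_cover V : finitely_generated V ->
  exists n (q : {linear 'rV[R]_n -> V}), surj q.
Proof.
move=> [s sP].
have ql : linear (fun v : 'rV[R]_(size s) => \sum_i v 0 i *: s`_i).
  move=> a u v; rewrite scaler_sumr -big_split /=; apply: eq_bigr => i _.
  by rewrite !mxE scalerDl scalerA.
exists (size s), (linmap ql) => v; have [c ->] := sP v.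
by exists (\row_i c i) => /=; apply: eq_bigr => i _; rewrite mxE.
Qed.

(** A resolution of V by finite free modules of row vectors; the differential
    from degree j+1 to degree j is right multiplication by [fmat j]. *)
Record free_resolution V := FreeResolution {
  fdim : nat -> nat;
  fmat : forall j, 'M[R]_(fdim j.+1, fdim j);
  faug : {linear 'rV[R]_(fdim 0) -> V};
  faug_surj : surj faug;
  faug_exact : forall v, faug v = 0 <-> exists w, v = w *m fmat 0;
  fmat_exact : forall j (v : 'rV[R]_(fdim j.+1)),
    v *m fmat j = 0 <-> exists w, v = w *m fmat j.+1 }.

Lemma fmatM V (F : free_resolution V) j : fmat F j.+1 *m fmat F j = 0.
Proof.
by apply: row_eq0 => v; rewrite mulmxA; apply/fmat_exact; exists v.
Qed.

(** A matrix whose row space is the kernel of A. *)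
Definition mx_syzygy (noeth : noetherian R) m n (A : 'M[R]_(m, n)) :
  {p & {B : 'M[R]_(p, m) | forall v : 'rV[R]_m, v *m A = 0 <-> exists w, v = w *m B}}.
Proof.
have /cid [p /cid [B BP]] :=
  submodule_rows noeth (submodule_ker (mulmxr A : {linear 'rV_m -> 'rV_n})).
by exists p, B.
Qed.

Section Extend.
Variables (noeth : noetherian R) (n m : nat) (A : 'M[R]_(m, n)).

(** Iterated syzygies of A: each state is a matrix packed with its height and width,
    and the width of the next state is convertible to the height of this one. *)
Fixpoint syzygies j : {p & {q & 'M[R]_(p, q)}} :=
  match j with
  | 0 => Tagged (fun p => {q & 'M[R]_(p, q)}) (Tagged (fun q => 'M[R]_(m, q)) A)
  | j'.+1 => let S := mx_syzygy noeth (tagged (tagged (syzygies j'))) in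
    Tagged (fun p => {q & 'M[R]_(p, q)}) (Tagged (fun q => 'M[R]_(tag S, q)) (sval (tagged S)))
  end.

Definition syz_dim j : nat := match j with 0 => n | j'.+1 => tag (syzygies j') end.

Definition syz_mat j : 'M[R]_(syz_dim j.+1, syz_dim j) :=
  match j return 'M[R]_(syz_dim j.+1, syz_dim j) with
  | 0 => A
  | j'.+1 => tagged (tagged (syzygies j'.+1))
  end.

Lemma syz_exact j (v : 'rV[R]_(syz_dim j.+1)) :
  v *m syz_mat j = 0 <-> exists w, v = w *m syz_mat j.+1.
Proof.
case: j v => [|j] v; first exact: (svalP (tagged (mx_syzygy noeth A)) v).
exact: (svalP (tagged (mx_syzygy noeth _)) v).
Qed.

End Extend.

(** Over a Noetherian ring a presentation extends to a free resolution. *)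
Definition presentation_resolution V n m (A : 'M[R]_(m, n)) (q : {linear 'rV[R]_n -> V})
  (noeth : noetherian R) (qs : surj q) (qA : forall v, q v = 0 <-> exists w, v = w *m A)
  : free_resolution V :=
  @FreeResolution V (syz_dim noeth A) (syz_mat noeth A) q qs qA
    (@syz_exact noeth n m A).

Lemma fg_resolution V : noetherian R -> finitely_generated V ->
  inhabited (free_resolution V).
Proof.
move=> noeth /fg_cover [n [q qs]].
have [m [A qA]] := submodule_rows noeth (submodule_ker q).
exact/inhabits/(presentation_resolution noeth qs qA).
Qed.

End Noetherian.

(** * Ext with values in the ring, read on a free resolution *)

Section DualResolution.
Variable R : comNzRingType.
Variable J : inj_resolution (R^o : lmodType R).
Implicit Types V W : lmodType R.

Lemma col_inj m (u w : 'cV[R]_m) : (forall v : 'rV_m, (v *m u) 0 0 = (v *m w) 0 0) -> u = w.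
Proof.
move=> uw; apply/colP => i; have := uw (delta_mx 0 i).
by rewrite -!rowE !mxE.
Qed.

(** The first syzygy K, as the image of the first differential, with its embedding i
    and the map q onto it. *)
Lemma first_syzygy V (F : free_resolution V) :
  exists (K : lmodType R) (i : {linear K -> 'rV[R]_(fdim F 0)})
         (q : {linear 'rV[R]_(fdim F 1) -> K}) (qs : surj q)
         (qk : forall v, q v = 0 <-> exists w, v = w *m fmat F 1),
    ses i (faug F) /\ forall v, i (q v) = v *m fmat F 0.
Proof.
have [K [q [i [qs ii iq]]]] :=
  image_exists (mulmxr (fmat F 0) : {linear 'rV_(fdim F 1) -> 'rV_(fdim F 0)}).
have qk v : q v = 0 <-> exists w, v = w *m fmat F 1.
  rewrite -fmat_exact; move: (iq v) => /= <-.
  by split=> [->|e]; [rewrite linear0 | apply: ii; rewrite e linear0].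
exists K, i, q, qs, qk; split=> //; split=> //; first exact: faug_surj.
move=> v; rewrite faug_exact; split=> [[w ->]|[x <-]].
  by exists (q w); rewrite iq.
by have [w <-] := qs x; exists w; rewrite iq.
Qed.

(** The resolution of the first syzygy K obtained by dropping the term of degree 0. *)
Definition shift_resolution V (F : free_resolution V) (K : lmodType R)
    (q : {linear 'rV[R]_(fdim F 1) -> K}) (qs : surj q)
    (qk : forall v, q v = 0 <-> exists w, v = w *m fmat F 1) : free_resolution K :=
  @FreeResolution R K (fun j => fdim F j.+1) (fun j => fmat F j.+1) q qs qk
    (fun j => @fmat_exact _ _ F j.+1).

Lemma Ext_divisible_dual y e V (F : free_resolution V) : Ext_divisible J y e V ->
  forall u : 'cV[R]_(fdim F e.+1), fmat F e.+1 *m u = 0 ->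
  exists u' w, fmat F e.+1 *m u' = 0 /\ u = y *: u' + fmat F e *m w.
Proof.
elim: e V F => [|e IH] V F dv u u0.
  have [K [i [q [qs [qk [iF iq]]]]]] := first_syzygy F.
  have [|f fq] := @factor_surj _ _ _ _ q (col_map u) qs.
    by move=> _ /qk [w ->]; rewrite /= -mulmxA u0 mulmx0 mxE.
  have [f' [g fE]] := Ext_divisible_base iF (@Ext_vanishes_rV _ _ J 0 _) dv f.
  have [u' u'E] := rV_linear_col (f' \o q : {linear 'rV[R]_(fdim F 1) -> R^o}).
  have [w wE] := rV_linear_col g.
  exists u', w; split.
    apply: col_inj => v; rewrite mulmxA -u'E /= mulmx0 mxE.
    suff -> : q (v *m fmat F 1) = 0 by rewrite linear0.
    by apply/qk; exists v.
  apply: col_inj => v; have := fE (q v); rewrite fq iq wE /= => ->.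
  rewrite mulmxDr -scalemxAr [RHS]mxE mulmxA; congr (_ + _).
  by rewrite [RHS]mxE -u'E.
have [K [i [q [qs [qk [iF iq]]]]]] := first_syzygy F.
apply: (IH K (shift_resolution qs qk)) => //.
by apply: (Ext_divisible_quo iF _ dv); apply: Ext_vanishes_rV.
Qed.

Lemma Ext_vanishes_dual e V (F : free_resolution V) : Ext_vanishes J e V ->
  forall u : 'cV[R]_(fdim F e.+1), fmat F e.+1 *m u = 0 -> exists w, u = fmat F e *m w.
Proof.
move=> van u u0.
have [u' [w [_ ->]]] := Ext_divisible_dual (Ext_vanishes_div van 0) u0.
by exists w; rewrite scale0r add0r.
Qed.

Lemma dual_Ext_vanishes e V (F : free_resolution V) :
  (forall u : 'cV[R]_(fdim F e.+1), fmat F e.+1 *m u = 0 -> exists w, u = fmat F e *m w) ->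
  Ext_vanishes J e V.
Proof.
elim: e V F => [|e IH] V F dual.
  have [K [i [q [qs [qk [iF iq]]]]]] := first_syzygy F.
  apply: (Ext_vanishes_base iF); first exact: Ext_vanishes_rV.
  move=> f; have [u uE] := rV_linear_col (f \o q : {linear 'rV[R]_(fdim F 1) -> R^o}).
  have [|w uw] := dual u.
    apply: col_inj => v; rewrite mulmxA -uE /= mulmx0 mxE.
    suff -> : q (v *m fmat F 1) = 0 by rewrite linear0.
    by apply/qk; exists v.
  exists (col_map w) => x; have [v <-] := qs x.
  by move: (uE v) => /= ->; rewrite uw iq mulmxA.
have [K [i [q [qs [qk [iF iq]]]]]] := first_syzygy F.
apply: (Ext_vanishes_quo iF); last exact: Ext_vanishes_rV.
exact: (IH K (shift_resolution qs qk)).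
Qed.

(** Nakayama's lemma for Ext: the ring morphism to k is the reduction of a local
    ring modulo its maximal ideal.  A matrix congruent to the identity modulo y
    has determinant mapped to 1, so it is invertible. *)
Lemma Ext_nakayama (k : fieldType) (phi : {rmorphism R -> k}) (y : R) e V :
  noetherian R -> (forall a, phi a != 0 -> exists b, a * b = 1) -> phi y = 0 ->
  finitely_generated V -> Ext_divisible J y e V -> Ext_vanishes J e V.
Proof.
move=> noeth units y0 fgV dv; have [F] := fg_resolution noeth fgV.
apply: (dual_Ext_vanishes (F := F)).
have PS : submodule (fun v : 'rV[R]_(fdim F e.+1) => fmat F e.+1 *m v^T = 0).
  split=> [|a u v u0 v0]; first by rewrite trmx0 mulmx0.
  by rewrite linearD linearZ /= mulmxDr -scalemxAr u0 v0 scaler0 addr0.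
have [s [U UP]] := submodule_rows noeth PS.
have /choice [c /choice [w cwE]] (i : 'I_s) : exists c, exists w,
    row i U = y *: (c *m U) + w *m (fmat F e)^T.
  have /(Ext_divisible_dual dv) [u' [w [u'0 uE]]] : fmat F e.+1 *m (row i U)^T = 0.
    by apply/UP; exists (delta_mx 0 i); rewrite rowE.
  have /UP [c cE] : fmat F e.+1 *m u'^T^T = 0 by rewrite trmxK.
  exists c, w^T; rewrite -[row i U]trmxK uE linearD linearZ /= cE trmx_mul.
  by [].
(* The generators U of the kernel satisfy (1 - y C) U = W (fmat F e)^T. *)
pose C := \matrix_i c i; pose W := \matrix_i w i.
have UE : U = y *: (C *m U) + W *m (fmat F e)^T.
  apply/row_matrixP => i; rewrite linearD linearZ /= !row_mul !rowK; exact: cwE.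
pose A := 1%:M - y *: C.
have AU : A *m U = W *m (fmat F e)^T.
  by rewrite mulmxBl mul1mx -scalemxAl {1}UE addrC addKr.
have [|b detb] := units (\det A).
  rewrite -det_map_mx map_mxB map_mxZ map_mx1 y0 scale0r subr0 det1.
  exact: oner_neq0.
have bU : U = (b *: (\adj A *m W)) *m (fmat F e)^T.
  rewrite -scalemxAl -mulmxA -AU mulmxA mul_adj_mx mul_scalar_mx scalerA.
  by rewrite mulrC detb scale1r.
move=> u u0; have /UP [c0 c0E] : fmat F e.+1 *m u^T^T = 0 by rewrite trmxK.
exists (c0 *m (b *: (\adj A *m W)))^T.
by rewrite -[LHS]trmxK c0E bU mulmxA trmx_mul trmxK.
Qed.

End DualResolution.

(** * Ideals of a local Noetherian ring *)

Section Ideals.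
Variable R : comNzRingType.

Lemma submoduleMl (I : R^o -> Prop) (a b : R) : submodule I -> I b -> I (a * b).
Proof. exact: submoduleZ. Qed.

(** Induction on ideals along reverse inclusion, from the ascending chain condition. *)
Lemma noetherian_ind (P : (R^o -> Prop) -> Prop) : noetherian R ->
  (forall I, submodule I ->
     (forall I', submodule I' -> (forall a, I a -> I' a) -> (exists a, I' a /\ ~ I a) -> P I') ->
     P I) ->
  forall I, submodule I -> P I.
Proof.
move=> noeth step I0 I0S; apply: contrapT => nPI0.
pose T := {I : R^o -> Prop | submodule I /\ ~ P I}.
have /choice [f fP] (I : T) : exists I' : T,
    (forall a, sval I a -> sval I' a) /\ exists a, sval I' a /\ ~ sval I a.
  case: I => I [IS nPI]; apply: contrapT => no; apply: (nPI); apply: step => // I' I'S II' ne.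
  apply: contrapT => nPI'; apply: no.
  by exists (exist _ I' (conj I'S nPI')).
pose c n : T := iter n f (exist _ I0 (conj I0S nPI0)).
have cS n : submodule (sval (c n)) by case: (svalP (c n)).
have mono m n : (m <= n)%N -> forall a, sval (c m) a -> sval (c n) a.
  elim: n => [|n IH]; first by rewrite leqn0 => /eqP ->.
  rewrite leq_eqVlt => /orP [/eqP -> //|lemn] a cma.
  by case: (fP (c n)) => sub _; apply/sub/IH.
have US : submodule (fun a => exists n, sval (c n) a).
  split=> [|a u v [m cu] [n cv]]; first by exists 0%N; case: (cS 0%N).
  exists (maxn m n); case: (cS (maxn m n)) => _; apply.
    exact: mono (leq_maxl m n) _ cu.
  exact: mono (leq_maxr m n) _ cv.
have [s sP] := ideal_fg noeth US.
have [N cN] : exists N, forall a, a \in s -> sval (c N) a.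
  have : forall a, a \in s -> exists n, sval (c n) a by move=> a /mem_span /sP.
  elim: (s) => [|a t IH] st; first by exists 0%N.
  have [n cn] := st a (mem_head _ _).
  have [|N cN] := IH; first by move=> b bt; apply: st; rewrite inE bt orbT.
  exists (maxn n N) => b; rewrite inE => /orP [/eqP ->|/cN cb].
    exact: mono (leq_maxl n N) _ cn.
  exact: mono (leq_maxr n N) _ cb.
have [_ [a [ca nca]]] := fP (c N).
apply: nca; apply: (span_sub (cS N) cN); apply/sP.
by exists N.+1.
Qed.

Lemma proper_idealr (I : R^o -> Prop) : submodule I -> ~ I 1 ->
  exists M : idealr R, forall a, a \in M <-> I a.
Proof.
move=> IS nI1; pose S : R -> bool := fun a => `[< I a >].
have cl : idealr_closed S.
  split=> [||a u v /asboolP Iu /asboolP Iv].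
  - by apply/asboolP; case: IS.
  - by apply/negP => /asboolP.
  - by apply/asboolP; case: IS => _; apply.
pose M : idealr R := HB.pack S (isIdealr.Build R S cl).
by exists M => a; split=> /asboolP.
Qed.

Lemma idealr_submodule (M : idealr R) : submodule (fun a : R^o => (a : R) \in M).
Proof.
split=> [|a u v uM vM]; first exact: idealr0.
by apply: rpredD => //; apply: idealMr.
Qed.

Lemma maximal_exists (I : R^o -> Prop) : noetherian R -> submodule I -> ~ I 1 ->
  exists M : idealr R, maximal_ideal M /\ forall a, I a -> a \in M.
Proof.
move=> noeth; move: I.
apply: (noetherian_ind (P := fun I => ~ I 1 ->
  exists M : idealr R, maximal_ideal M /\ forall a, I a -> a \in M) noeth) => I IS IH nI1.
have [M MI] := proper_idealr IS nI1.
case: (pselect (maximal_ideal M)) => [Mmax|nmax]; first by exists M; split=> // a /MI.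
have [I' nI'] : exists I' : idealr R,
    ~ ((forall a, a \in M -> a \in I') -> forall a, a \in I' -> a \in M).
  by apply: contrapT => no; apply: nmax => I'; apply: contrapT => h; apply: no; exists I'.
have sub a : a \in M -> a \in I'.
  by move=> aM; apply: contrapT => naI'; apply: nI' => h; case: naI'; apply: h.
have [a [aI' naM]] : exists a, a \in I' /\ a \notin M.
  apply: contrapT => no; apply: nI' => _ a aI'; apply: contrapT => /negP naM.
  by apply: no; exists a.
have [|||N [Nmax NI]] := IH _ (idealr_submodule I').
- by move=> b /MI /sub.
- by exists a; split=> // /MI; apply/negP.
- by rewrite idealr1.
by exists N; split=> // b /MI /sub /NI.
Qed.

Lemma submodule_rker (A : pzRingType) (f : {rmorphism R -> A}) :
  submodule (fun a : R^o => f a = 0).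
Proof.
split=> [|a u v u0 v0]; first exact: rmorph0.
by rewrite rmorphD v0 addr0 (rmorphM f a u) u0 mulr0.
Qed.

Section Residue.
Variables (k : fieldType) (phi : {rmorphism R -> k}).
Hypothesis phi_surj : surj phi.

(** In a local ring the elements outside the kernel of a surjection onto a field
    are invertible. *)
Lemma local_units : local_ring R -> forall a, phi a != 0 -> exists b, a * b = 1.
Proof.
move=> [noeth [m [mmax muniq]]] a pa; apply: contrapT => nu.
have aS : submodule (fun c : R^o => exists b : R, c = a * b).
  split=> [|c _ _ [b ->] [b' ->]]; first by exists 0; rewrite mulr0.
  by exists (c * b + b'); rewrite mulrDr mulrCA.
have [|M [Mmax MI]] := maximal_exists noeth aS.
  by move=> [b e]; apply: nu; exists b.
have [|N NP] := proper_idealr (submodule_rker phi).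
  by rewrite rmorph1; apply/eqP/oner_neq0.
have Nmax : maximal_ideal N.
  move=> I NI c cI; apply/NP; apply: contrapT => /eqP pc.
  have [b pb] := phi_surj (phi c)^-1.
  have : 1 - b * c \in I.
    by apply/NI/NP; rewrite rmorphB rmorphM rmorph1 pb mulVf // subrr.
  move=> h; have := rpredD h (idealMr b cI); rewrite subrK idealr1.
  by [].
have aN : a \in N.
  by rewrite (muniq _ Nmax) -(muniq _ Mmax); apply: MI; exists 1; rewrite mulr1.
by move/NP: aN => /eqP; apply/negP.
Qed.

End Residue.
End Ideals.

(** * Vanishing of Ext with values in the ring *)

Section Cyclic.
Variable R : comNzRingType.
Variable J : inj_resolution (R^o : lmodType R).
Implicit Types (V W : lmodType R) (I : R^o -> Prop).

Lemma cokernel_exists V W (f : {linear V -> W}) :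
  exists (C : lmodType R) (p : {linear W -> C}), surj p /\ exact f p.
Proof.
by have [C [p [ps pk]]] := quotient_exists (submodule_img f); exists C, p.
Qed.

(** The linear map a |-> a v. *)
Definition orbit_map V (v : V) : {linear R^o -> V}.
Proof.
apply: (@linmap _ _ _ (fun a : R^o => (a : R) *: v)).
by move=> a b c; rewrite scalerDl scalerA.
Defined.

Definition scale_map V (y : R) : {linear V -> V} := y \*: (idfun : {linear V -> V}).

Lemma linear_mul V (f : {linear R^o -> V}) (a b : R) : f (a * b) = a *: f b.
Proof. exact: linearZ. Qed.

Lemma span_subset V (s t : seq V) v : {subset s <= t} -> in_span s v -> in_span t v.
Proof.
by move=> st; apply: span_sub (submodule_span t) _ => u /st /mem_span.
Qed.

Lemma fg_regular : finitely_generated (R^o : lmodType R).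
Proof.
exists [:: (1 : R^o)] => a; rewrite -[a]mulr1.
by apply: (submoduleZ a (submodule_span _)); apply: mem_span; rewrite mem_head.
Qed.

Lemma fg_prod V W : finitely_generated V -> finitely_generated W ->
  finitely_generated (V * W)%type.
Proof.
move=> [s sP] [t tP].
have il : linear (fun v : V => (v, 0 : W)).
  by move=> a u v; congr (_, _); rewrite /= scaler0 addr0.
have jl : linear (fun w : W => (0 : V, w)).
  by move=> a u v; congr (_, _); rewrite /= scaler0 addr0.
exists ([seq linmap il v | v <- s] ++ [seq linmap jl w | w <- t]) => -[v w].
have -> : (v, w) = linmap il v + linmap jl w by congr (_, _); rewrite /= ?addr0 ?add0r.
apply: (submoduleD (submodule_span _)).
  by apply: span_subset (span_map _ (sP v)) => u us; rewrite mem_cat us.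
by apply: span_subset (span_map _ (tP w)) => u us; rewrite mem_cat us orbT.
Qed.

(** [Ext_cyclic e I] says that Ext^(e+1)(R/I, R) = 0, for every model of R/I. *)
Definition Ext_cyclic e I : Prop := forall V (q : {linear R^o -> V}),
  surj q -> (forall a, q a = 0 <-> I a) -> Ext_vanishes J e V.

(** [Ext_fg e] says that Ext^(e+1)(-, R) vanishes on finitely generated modules. *)
Definition Ext_fg e : Prop := forall V, finitely_generated V -> Ext_vanishes J e V.

Lemma Ext_cyclicI e I V (q : {linear R^o -> V}) :
  surj q -> (forall a, q a = 0 <-> I a) -> Ext_vanishes J e V -> Ext_cyclic e I.
Proof.
move=> qs qI van W p ps pI; apply: Ext_vanishes_iso qs ps _ van.
by move=> a; rewrite qI pI.
Qed.

Lemma Ext_cyclic_ext e I I' : (forall a, I a <-> I' a) -> Ext_cyclic e I -> Ext_cyclic e I'.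
Proof. by move=> II' cI V q qs qI; apply: (cI V q qs) => a; rewrite qI II'. Qed.

(** If Ext^(e+2)(-, R) vanishes, then the vanishing of Ext^(e+1)(-, R) passes to
    submodules. *)
Lemma Ext_vanishes_top e V W (i : {linear V -> W}) : Ext_fg e.+1 -> injective i ->
  finitely_generated W -> Ext_vanishes J e W -> Ext_vanishes J e V.
Proof.
move=> top ii fgW van; have [C [p [ps ip]]] := cokernel_exists i.
apply: (@Ext_vanishes_sub _ _ _ _ _ _ i p) van _; first by split.
exact/top/(fg_surj ps).
Qed.

(** The case of the cyclic submodule generated by w, which has annihilator I. *)
Lemma Ext_cyclic_top e I W (w : W) : Ext_fg e.+1 -> finitely_generated W ->
  Ext_vanishes J e W -> (forall a : R, I a <-> a *: w = 0) -> Ext_cyclic e I.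
Proof.
move=> top fgW van Iw V q qs qI.
have [|h hq] := @factor_surj _ _ _ _ q (orbit_map w) qs; first by move=> a /qI /Iw.
apply: (@Ext_vanishes_top _ _ _ h) => //.
move=> u v; have [a <-] := qs u; have [b <-] := qs v; rewrite !hq => /= e1.
apply/eqP; rewrite -subr_eq0 -linearB; apply/eqP/qI/Iw.
by rewrite scalerBl e1 subrr.
Qed.

(** Every finitely generated module has a finite filtration with cyclic factors. *)
Lemma Ext_cyclic_fg e : (forall I, submodule I -> Ext_cyclic e I) -> Ext_fg e.
Proof.
move=> cyc V [s]; move: {2}(size s) (erefl (size s)) => n.
elim: n V s => [|n IH] V s ss sP.
  apply: Ext_vanishes0 => v; have [c ->] := sP v.
  by apply: big1 => -[i lti]; have l0 := lti; rewrite ss in l0.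
case: s ss sP => [|v s] //= [ss] sP.
have [K [q [i [qs ii iq]]]] := image_exists (orbit_map v).
have [C [p [ps ip]]] := cokernel_exists i.
apply: (@Ext_vanishes_mid _ _ _ _ _ _ i p) => //.
  exact: cyc (submodule_ker q) _ q qs (fun a => iff_refl _).
apply: (IH C [seq p u | u <- s]); first by rewrite size_map.
move=> w; have [u <-] := ps w; have := span_map p (sP u).
apply: (span_sub (submodule_span _)) => x /mapP [y]; rewrite inE => /orP [/eqP ->|ys] ->.
  suff -> : p v = 0 by case: (submodule_span [seq p u | u <- s]).
  by apply/ip; exists (q 1); rewrite iq /= scale1r.
exact/mem_span/map_f.
Qed.

Section Local.
Variables (k : fieldType) (phi : {rmorphism R -> k}).
Hypothesis noeth : noetherian R.
Hypothesis units : forall a, phi a != 0 -> exists b, a * b = 1.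

(** If Ext^(e+2)(-, R) vanishes and Ext^(e+1)(-, R) vanishes on the residue field,
    then Ext^(e+1)(-, R) vanishes. *)
Lemma Ext_residue e : Ext_fg e.+1 -> Ext_cyclic e (fun a => phi a = 0) -> Ext_fg e.
Proof.
move=> top res; apply: Ext_cyclic_fg; apply: (noetherian_ind noeth) => I IS IH V q qs qI.
have fgV : finitely_generated V := fg_surj qs fg_regular.
case: (pselect (exists a, I a /\ phi a != 0)) => [[a [Ia /units [b ab]]]|I0].
  apply: Ext_vanishes0 => v; have [c <-] := qs v; apply/qI.
  by rewrite -[c]mulr1 -ab (mulrC a) mulrA; apply: submoduleMl.
case: (pselect (exists y, phi y = 0 /\ ~ I y)) => [[y [y0 nIy]]|mI]; last first.
  apply: res qs _ => a; rewrite qI; split=> [Ia|a0].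
    by apply: contrapT => /eqP a0; apply: I0; exists a.
  by apply: contrapT => nIa; apply: mI; exists a.
have [C [p [ps ip]]] := cokernel_exists (scale_map V y).
pose pq : {linear R^o -> C} := p \o q.
have pqs : surj pq.
  by move=> c; have [v <-] := ps c; have [a <-] := qs v; exists a.
have pqI a : pq a = 0 <-> exists b, I (a - y * b).
  split=> [/ip [v]|[b] /qI e0].
    have [b <-] := qs v => /= e0; exists b; apply/qI.
    by rewrite linearB -e0 linear_mul subrr.
  by apply/ip; exists (q b); apply/eqP; rewrite eq_sym -subr_eq0 /= -linear_mul -linearB; apply/eqP.
have vanC : Ext_vanishes J e C.
  apply: (IH (fun a => pq a = 0) _ _ _ C pq pqs) => //; first exact: submodule_ker.
    by move=> a Ia; apply/pqI; exists 0; rewrite mulr0 subr0.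
  exists y; split=> //; apply/pqI; exists 1; rewrite mulr1 subrr; by case: IS.
case: (pselect (injective (scale_map V y))) => [yi|nyi].
  apply: (Ext_nakayama noeth units y0 fgV).
  apply: (@Ext_divisible_scale _ _ _ y e V C (scale_map V y) p) => //.
  exact/top/(fg_surj ps).
have [K [q' [i [qs' ii iq']]]] := image_exists (scale_map V y \o q : {linear R^o -> V}).
have qK a : q' a = 0 <-> I (y * a).
  rewrite -qI linear_mul -[y *: q a]/((scale_map V y \o q) a) -iq'.
  by split=> [->|e0]; [rewrite linear0 | apply: ii; rewrite e0 linear0].
apply: (@Ext_vanishes_mid _ _ _ _ _ _ i p) vanC.
  split=> // v; rewrite ip; split=> [[u]|[u]].
    by have [a <-] := qs u => <-; exists (q' a).
  by have [a <-] := qs' u => <-; exists (q a); rewrite iq'.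
apply: (IH (fun a => q' a = 0) _ _ _ K q' qs') => //; first exact: submodule_ker.
  by move=> a Ia; apply/qK; apply: submoduleMl.
apply: contrapT => no; apply: nyi => u v.
have [a <-] := qs u; have [b <-] := qs v => /= e0.
apply/eqP; rewrite -subr_eq0 -linearB; apply/eqP/qI; apply: contrapT => nab.
apply: no; exists (a - b); split=> //; apply/qK/qI.
by rewrite linear_mul linearB /= scalerBr e0 subrr.
Qed.

(** R modulo the annihilator of finitely many elements of R/X embeds in a power of
    R/X, one factor for each element. *)
Lemma Ext_cyclic_annihilator e X (s : seq R^o) : submodule X -> Ext_fg e.+1 -> Ext_cyclic e X ->
  Ext_cyclic e (fun a : R^o => forall g, g \in s -> X ((a : R) * g)).
Proof.
move=> XS top cX; have [W [p [ps pX]]] := quotient_exists XS.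
have fgW : finitely_generated W := fg_surj ps fg_regular.
elim: s => [|g s IH].
  move=> V q qs qI; apply: Ext_vanishes0 => v.
  by have [a <-] := qs v; apply/qI.
have IS : submodule (fun a : R^o => forall h, h \in s -> X ((a : R) * h)).
  split=> [h _|a u v Iu Iv h hs]; first by rewrite mul0r; case: XS.
  rewrite mulrDl; apply: (submoduleD XS); last exact: Iv.
  by rewrite -mulrA; apply: (submoduleMl _ XS) => //; apply: Iu.
have [W' [p' [ps' pI']]] := quotient_exists IS.
apply: (@Ext_cyclic_top e _ (W' * W)%type (p' 1, p g)) => //.
- by apply: fg_prod => //; apply: fg_surj ps' fg_regular.
- by apply: Ext_vanishes_prod; [apply: IH ps' pI' | apply: cX ps pX].
move=> a; have -> : a *: (p' 1, p g) = (p' a, p (a * g)).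
  by congr (_, _); rewrite /= -linear_mul ?mulr1.
split=> [Xa|[/pI' p'a /pX pa] h].
  congr (_, _); last by apply/pX/Xa/mem_head.
  by apply/pI' => h hs; apply: Xa; rewrite inE hs orbT.
by rewrite inE => /orP [/eqP -> //|]; apply: p'a.
Qed.

(** The ring R/X is assumed to have maximal ideal m/X = I1/X + I2/X, a direct sum
    of nonzero ideals. *)
Lemma Ext_cyclic_residue e (X I1 I2 : R^o -> Prop) :
  submodule X -> submodule I1 -> submodule I2 ->
  (forall a, X a <-> I1 a /\ I2 a) ->
  (forall a, phi a = 0 <-> exists b, I1 (a - b) /\ I2 b) ->
  (exists a, I1 a /\ ~ X a) -> (exists a, I2 a /\ ~ X a) ->
  Ext_fg e.+2 -> Ext_cyclic e X -> Ext_cyclic e.+1 X ->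
  Ext_cyclic e.+1 (fun a => phi a = 0).
Proof.
move=> XS I1S I2S I12 phiI neI1 neI2 top cX cX1.
have [W [p [ps pX]]] := quotient_exists XS.
have fgW : finitely_generated W := fg_surj ps fg_regular.
case: (pselect (exists s : R, ~ X s /\ forall a : R, phi a = 0 -> X (a * s)))
  => [[s [nXs ms]]|nosoc].
  (* The residue field embeds in R/X as the submodule generated by s. *)
  apply: (@Ext_cyclic_top _ _ W (p s)) => //; first exact: cX1 ps pX.
  move=> a; rewrite -linear_mul pX; split=> [/ms //|Xas].
  apply: contrapT => /eqP /units [b ab]; apply: nXs.
  by rewrite -[s]mul1r -ab (mulrC a) -mulrA; apply: submoduleMl.
have ann I I' : submodule I -> submodule I' -> (forall a, X a <-> I a /\ I' a) ->
    (forall a, phi a = 0 <-> exists b, I (a - b) /\ I' b) -> (exists a, I a /\ ~ X a) ->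
    Ext_cyclic e.+1 I'.
  (* I' is the annihilator of I modulo X, since R/X has no socle. *)
  move=> IS I'S II' sum [c [Ic nXc]]; have [s sP] := ideal_fg noeth IS.
  apply: (@Ext_cyclic_ext _ _ _ _ (@Ext_cyclic_annihilator _ _ s XS top cX1)) => a.
  split; last first.
    move=> I'a g /mem_span /sP Ig; apply/II'; split; first exact: submoduleMl.
    by rewrite mulrC; apply: submoduleMl.
  move=> Xas.
  have Xa g : I g -> X (a * g).
    move=> /sP; apply: (@span_sub _ _ (fun g => X (a * g))) => //.
    split=> [|b u v Xu Xv]; first by rewrite mulr0; case: XS.
    rewrite mulrDr; apply: (submoduleD XS) => //.
    by rewrite -[b *: u]/(b * u) mulrCA; apply: submoduleMl.
  have [b [Iab I'b]] : exists b, I (a - b) /\ I' b.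
    apply/sum; apply: contrapT => /eqP /units [b ab]; apply: nXc.
    rewrite -[c]mul1r -ab (mulrC a) -mulrA; apply: (submoduleMl _ XS) => //; exact: Xa.
  suff Xab : X (a - b) by rewrite -[a](subrK b); apply: (submoduleD I'S) => //; case/II': Xab.
  apply: contrapT => nXab; apply: nosoc; exists (a - b); split=> // m /sum [m' [Imm I'm]].
  rewrite -[m](subrK m') mulrDl; apply: (submoduleD XS) => //; last first.
    by apply/II'; split; [exact: submoduleMl | rewrite mulrC; apply: submoduleMl].
  rewrite mulrBr; apply: (submoduleB XS) => //; first by rewrite mulrC; apply: Xa.
  apply/II'; split; last exact: submoduleMl.
  by rewrite mulrC; apply: submoduleMl.
have c2 : Ext_cyclic e.+1 I2 by apply: ann phiI neI1.
have c1 : Ext_cyclic e.+1 I1.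
  apply: (ann I2 I1) => // a; first by rewrite I12; split=> -[].
  rewrite phiI; split=> -[b [h h']]; exists (a - b); rewrite opprB addrC subrK; split=> //.
(* The exact sequence 0 -> R/X -> R/I1 x R/I2 -> k -> 0. *)
have [W1 [p1 [ps1 pI1]]] := quotient_exists I1S.
have [W2 [p2 [ps2 pI2]]] := quotient_exists I2S.
have dl : linear (fun a : R^o => (p1 a, p2 a)).
  by move=> a u v; rewrite !linearP.
have [K [q [i [qs ii iq]]]] := image_exists (linmap dl).
have [C [r [rs ir]]] := cokernel_exists i.
have vanC : Ext_vanishes J e.+1 C.
  apply: (@Ext_vanishes_quo _ _ _ _ _ _ i r) => //.
    apply: cX qs _ => a; rewrite I12 -pI1 -pI2; split=> [qa|[e1 e2]].
      by have := iq a; rewrite qa linear0 => -[-> ->].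
    by apply: ii; rewrite iq linear0 /= e1 e2.
  by apply: Ext_vanishes_prod; [apply: c1 ps1 pI1 | apply: c2 ps2 pI2].
have r0 u : r u = 0 <-> exists a, u = (p1 a, p2 a).
  rewrite ir; split=> [[x <-]|[a ->]]; last by exists (q a); rewrite iq.
  by have [a <-] := qs x; exists a; rewrite iq.
have fl : linear (fun a : R^o => (p1 a, 0 : W2)).
  by move=> a u v; congr (_, _); rewrite /= ?linearP // scaler0 addr0.
apply: (@Ext_cyclicI _ _ _ (r \o linmap fl : {linear R^o -> C})) vanC.
  move=> c; have [[w1 w2] <-] := rs c; have [a <-] := ps1 w1; have [b <-] := ps2 w2.
  exists (a - b); apply/eqP; rewrite /= eq_sym -subr_eq0 -linearB /=; apply/eqP/r0.
  by exists b; congr (_, _); rewrite /= ?subr0 // linearB opprB addrC subrK.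
move=> a; rewrite /= r0 phiI; split=> [[b [e1 e2]]|[b [/pI1 e1 /pI2 e2]]].
  exists b; split; last exact/pI2.
  by apply/pI1; rewrite linearB e1 subrr.
exists b; rewrite e2; congr (_, _); apply/eqP; rewrite -subr_eq0 -linearB; exact/eqP.
Qed.

End Local.

Lemma in_span_rcons (s : seq R^o) (y a : R^o) :
  in_span (rcons s y) a <-> exists b : R, in_span s (a - (y : R) * b).
Proof.
split=> [sa|].
  apply: (@span_sub _ R^o (fun a => exists b : R, in_span s (a - (y : R) * b)) _ _ _ _ sa).
    split=> [|c u v [b bu] [b' bv]].
      by exists 0; rewrite mulr0 subr0; case: (submodule_span s).
    exists (c * b + b').
    have -> : c *: u + v - y * (c * b + b') = c *: (u - y * b) + (v - y * b').
      by rewrite mulrDr scalerBr opprD addrACA -[c *: (y * b)]/(c * (y * b)) mulrCA.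
    by case: (submodule_span s) => _; apply.
  move=> u; rewrite mem_rcons inE => /orP [/eqP ->|us].
    by exists 1; rewrite mulr1 subrr; case: (submodule_span s).
  by exists 0; rewrite mulr0 subr0; apply: mem_span.
move=> [b sb]; rewrite -[a](subrK (y * b)); apply: (submoduleD (submodule_span _)).
  by apply: span_subset sb => u us; rewrite mem_rcons inE us orbT.
rewrite mulrC; apply: (submoduleMl _ (submodule_span _)).
by apply: mem_span; rewrite mem_rcons mem_head.
Qed.

(** A quotient by a regular sequence of length i has projective dimension at most i,
    so its Ext vanishes in degrees above i. *)
Lemma Ext_cyclic_regular (s : seq R^o) i e : regular_sequence s ->
  (i <= size s)%N -> (i <= e)%N -> Ext_cyclic e (in_span (take i s)).
Proof.
move=> [_ reg]; elim: i e => [|i IH] e les lee.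
  apply: (@Ext_cyclicI e _ R^o (idfun : {linear R^o -> R^o})).
  - by move=> a; exists a.
  - move=> a /=; rewrite take0; split=> [->|[c ->]]; last by rewrite big_ord0.
    by case: (submodule_span (Nil R^o)).
  exact: Ext_vanishes_regular.
case: e lee => [|e] // lee.
have [V [q [qs qI]]] := quotient_exists (submodule_span (take i s)).
have [C [p [ps ip]]] := cokernel_exists (scale_map V (s`_i : R)).
have qy a : (s`_i : R) *: q a = q ((s`_i : R) * a) by rewrite linear_mul.
apply: (@Ext_cyclicI e.+1 _ C (p \o q : {linear R^o -> C})).
- by move=> c; have [v <-] := ps c; have [a <-] := qs v; exists a.
- move=> a; rewrite (take_nth 0 les) in_span_rcons; split=> [/ip [v]|[b] /qI e0].
    have [b <-] := qs v => /=; rewrite qy => e0; exists b; apply/qI.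
    by rewrite linearB /= e0 subrr.
  apply/ip; exists (q b); apply/eqP.
  by rewrite /= qy eq_sym -subr_eq0 -linearB; apply/eqP.
apply: (@Ext_vanishes_quo _ _ _ _ _ _ (scale_map V (s`_i : R)) p).
- split=> // u v; have [a <-] := qs u; have [b <-] := qs v => /= e0.
  apply/eqP; rewrite -subr_eq0 -linearB; apply/eqP/qI/(reg i les)/qI.
  by rewrite -qy linearB scalerBr e0 subrr.
- by apply: (IH e) qs qI; [apply: ltnW | ].
- by apply: (IH e.+1) qs qI; [apply: ltnW | apply: leqW].
Qed.

End Cyclic.

(** * Gorenstein quasi-fiber product rings *)

Section QuasiFiberProduct.
Variable R : comNzRingType.

Lemma not_injective_ker (A B : pzRingType) (f : {rmorphism A -> B}) :
  ~ injective f -> exists a, f a = 0 /\ a != 0.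
Proof.
move=> nf; apply: contrapT => no; apply: nf => a b e.
apply/eqP; rewrite -subr_eq0; apply/eqP; apply: contrapT => /eqP ab.
by apply: no; exists (a - b); split=> //; rewrite rmorphB e subrr.
Qed.

(** If R/(s) is a fiber product ring, then its maximal ideal is the direct sum of
    two nonzero ideals, whose inverse images in R are I1 and I2. *)
Lemma quasi_fiber_decomposition (s : seq R^o) : quasi_fiber_product_ring s ->
  exists (k : fieldType) (phi : {rmorphism R -> k}) (I1 I2 : R^o -> Prop),
  [/\ surj phi, submodule I1 /\ submodule I2,
      forall a, in_span s a <-> I1 a /\ I2 a,
      forall a, phi a = 0 <-> exists b, I1 (a - b) /\ I2 b &
      (exists a, I1 a /\ ~ in_span s a) /\ (exists a, I2 a /\ ~ in_span s a)].
Proof.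
move=> [_ _ [I [IX [_ [S [T [k [pS [pT [_ [sS sT] [nS nT] [f [g fK gK]]]]]]]]]]]].
pose p : {rmorphism R -> {ideal_quot I}} := \pi_({ideal_quot I})%qT.
pose v : {rmorphism Defs.fprod pS pT -> (S * T)%type} := \val.
pose gS : {rmorphism R -> S} := fst \o (v \o (f \o p)).
pose gT : {rmorphism R -> T} := snd \o (v \o (f \o p)).
have lift st : pS st.1 = pT st.2 -> exists a, gS a = st.1 /\ gT a = st.2.
  move=> e; have pe : st \in fprod_pred pS pT by apply/eqP.
  exists (generic_quotient.repr (g (Defs.FProd pe))).
  by rewrite /gS /gT /= /p /= generic_quotient.reprK gK.
have pST a : pS (gS a) = pT (gT a) by rewrite /gS /gT /=; case: (f (p a)) => u pu /=; exact/eqP.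
have gX a : in_span s a <-> gT a = 0 /\ gS a = 0.
  rewrite -IX; have -> : (a \in I) <-> p a = 0.
    split=> [aI|e].
      apply/eqP; rewrite -[0](rmorph0 p) /p /= -Quotient.idealrBE subr0.
      exact: aI.
    have /eqP := e; rewrite -[0](rmorph0 p) /p /= -Quotient.idealrBE subr0.
    by [].
  split=> [pa|[T0 S0]]; first by rewrite /gT /gS /= pa rmorph0.
  apply: (can_inj fK); apply: val_inj; rewrite !rmorph0 /=.
  by move: T0 S0; rewrite /gT /gS /=; case: (val (f (p a))) => x y /= -> ->.
pose phi : {rmorphism R -> k} := pS \o gS.
have phiE a : phi a = pS (gS a) by [].
exists k, phi, (fun a => gT a = 0), (fun a => gS a = 0); split=> //.
- move=> c; have [x xc] := sS c; have [y yc] := sT c.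
  have [|a [aS _]] := lift (x, y); first by rewrite /= xc yc.
  by exists a; rewrite phiE aS.
- by split; apply: submodule_rker.
- move=> a; rewrite phiE; split=> [a0|[b [ab b0]]]; last first.
    rewrite pST; move/eqP: ab; rewrite rmorphB subr_eq0 => /eqP ->.
    by rewrite -pST b0 rmorph0.
  have [|b [bS bT]] := lift (0, gT a); first by rewrite /= rmorph0 -pST.
  by exists b; rewrite rmorphB bT /= subrr.
- split.
    have [x [x0 nx]] := not_injective_ker nS.
    have [|a [aS aT]] := lift (x, 0); first by rewrite /= rmorph0.
    exists a; split=> // /gX [_ a0]; move: nx; rewrite -[x]/((x, 0 : T).1) -aS a0.
    by rewrite eqxx.
  have [x [x0 nx]] := not_injective_ker nT.
  have [|a [aS aT]] := lift (0, x); first by rewrite /= rmorph0.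
  exists a; split=> // /gX [a0 _]; move: nx; rewrite -[x]/((0 : S, x).2) -aT a0.
  by rewrite eqxx.
Qed.

(** A Gorenstein quasi-fiber product ring with respect to a sequence of length n
    has injective dimension at most n + 1. *)
Lemma gorenstein_Ext_vanishes (s : seq R^o) :
  gorenstein R -> quasi_fiber_product_ring s ->
  exists J : inj_resolution (R^o : lmodType R),
    forall e, (size s < e)%N -> Ext_fg J e.
Proof.
move=> [loc [J [d Jd]]] qfp; exists J; have [_ reg _] := qfp.
have [k [phi [I1 [I2 [phis [I1S I2S] I12 sum [ne1 ne2]]]]]] := quasi_fiber_decomposition qfp.
have units := local_units phis loc; have [noeth _] := loc.
have cyc e : (size s <= e)%N -> Ext_cyclic J e (in_span s).
  by move=> le; have := @Ext_cyclic_regular _ J s (size s) e reg (leqnn _) le; rewrite take_size.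
have fg j : forall e, (size s < e)%N -> (d <= e + j)%N -> Ext_fg J e.
  elim: j => [|j IH] e lte le.
    move=> V _ f _; exists \0 => v.
    by rewrite linear0; apply: Jd; rewrite ltnS -[e]addn0.
  have top : Ext_fg J e.+1 by apply: IH; [apply: ltnW | rewrite addSnnS].
  case: e lte le top => [|e] // lte le top.
  apply: (Ext_residue noeth units top).
  apply: (Ext_cyclic_residue noeth units (submodule_span s) I1S I2S) => //.
    exact: cyc.
  by apply: cyc; apply: ltnW.
by move=> e lte; apply: (fg d) => //; apply: leq_addl.
Qed.

End QuasiFiberProduct.

(** * Comparison of resolutions *)

Section Comparison.
Variable R : comNzRingType.
Implicit Types V W N P : lmodType R.

Lemma projective_lift P V W (f : {linear V -> W}) (g : {linear P -> W}) :
  projective P -> (forall p, exists v, f v = g p) ->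
  exists h : {linear P -> V}, forall p, f (h p) = g p.
Proof.
move=> pP fg; have [K [q [i [qs ii iq]]]] := image_exists f.
have [|g' ig'] := @factor_inj _ _ _ _ i g ii.
  by move=> p; have [v <-] := fg p; exists (q v).
have [h qh] := pP _ _ q g' qs.
by exists h => p; rewrite -iq qh ig'.
Qed.

Section Homotopy.
Variables (V : lmodType R) (F : free_resolution V) (P : proj_resolution V).

Local Notation T j := 'rV[R]_(fdim F j).
Local Notation D j := (mulmxr (fmat F j) : {linear T j.+1 -> T j}).

Lemma pdiff_comp j p : pdiff P j (pdiff P j.+1 p) = 0.
Proof. by apply/(@pdiff_exact _ _ P j); exists p. Qed.

Lemma fdiff_comp j v : D j (D j.+1 v) = 0.
Proof. by rewrite /= -mulmxA fmatM mulmx0. Qed.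

Lemma fdiff_lift j v : D j v = 0 -> exists w, D j.+1 w = v.
Proof. by move=> /fmat_exact [w ->]; exists w. Qed.

Lemma faug_lift v : faug F v = 0 -> exists w, D 0 w = v.
Proof. by move=> /faug_exact [w ->]; exists w. Qed.

(** The comparison maps a : F -> P and b : P -> F and the homotopy s from b a to
    the identity of F, around degree j+1. *)
Lemma comparison j :
  exists (a0 : {linear T j -> pterm P j}) (a1 : {linear T j.+1 -> pterm P j.+1})
         (b1 : {linear pterm P j.+1 -> T j.+1}) (b2 : {linear pterm P j.+2 -> T j.+2})
         (s0 : {linear T j -> T j.+1}) (s1 : {linear T j.+1 -> T j.+2}),
  [/\ forall v, pdiff P j (a1 v) = a0 (D j v),
      forall p, D j.+1 (b2 p) = b1 (pdiff P j.+1 p) &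
      forall v, v = b1 (a1 v) + s0 (D j v) + D j.+1 (s1 v)].
Proof.
elim: j => [|j [a0 [a1 [b1 [b2 [s0 [s1 [aE bE sE]]]]]]]].
  have pa v : paug P (pdiff P 0%N v) = 0 by apply/(@paug_exact _ _ P); exists v.
  have fa v : faug F (D 0 v) = 0 by apply/faug_exact; exists v.
  have [|a0 a0E] := @rV_lift _ _ _ _ (paug P) (faug F); first by move=> v; apply: paug_surj.
  have [|b0 b0E] := @projective_lift _ _ _ (faug F) (paug P) (@pterm_projective _ _ P 0%N).
    by move=> v; apply: faug_surj.
  have [|a1 a1E] := @rV_lift _ _ _ _ (pdiff P 0%N) (a0 \o D 0 : {linear T 1 -> _}).
    by move=> v; apply/(@paug_exact _ _ P); rewrite a0E fa.
  have [|b1 b1E] := @projective_lift _ _ _ (D 0) (b0 \o pdiff P 0%N : {linear _ -> T 0})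
      (@pterm_projective _ _ P 1%N).
    by move=> p; apply: faug_lift; rewrite b0E pa.
  have [|b2 b2E] := @projective_lift _ _ _ (D 1) (b1 \o pdiff P 1%N : {linear _ -> T 1})
      (@pterm_projective _ _ P 2%N).
    by move=> p; apply: fdiff_lift; rewrite b1E /= pdiff_comp linear0.
  have [|s0 s0E] := @rV_lift _ _ _ _ (D 0) (idfun \- (b0 \o a0) : {linear T 0 -> T 0}).
    by move=> v; apply: faug_lift; rewrite /= linearB b0E a0E subrr.
  have [|s1 s1E] := @rV_lift _ _ _ _ (D 1)
      (idfun \- (b1 \o a1) \- (s0 \o D 0) : {linear T 1 -> T 1}).
    move=> v; apply: fdiff_lift; rewrite linearB s0E /= mulmxBl.
    have /= -> := b1E (a1 v).
    by rewrite a1E /= subrr.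
  exists a0, a1, b1, b2, s0, s1; split=> // v.
  by rewrite s1E /= -addrA [s0 _ + _]addrC subrK addrC subrK.
have [|a2 a2E] := @rV_lift _ _ _ _ (pdiff P j.+1) (a1 \o D j.+1 : {linear T j.+2 -> _}).
  move=> v; apply/(@pdiff_exact _ _ P j); rewrite /= aE.
  by have /= -> := fdiff_comp v; rewrite linear0.
have [|b3 b3E] := @projective_lift _ _ _ (D j.+2) (b2 \o pdiff P j.+2 : {linear _ -> T j.+2})
    (@pterm_projective _ _ P j.+3).
  by move=> p; apply: fdiff_lift; rewrite bE /= pdiff_comp linear0.
have [|s2 s2E] := @rV_lift _ _ _ _ (D j.+2)
    (idfun \- (b2 \o a2) \- (s1 \o D j.+1) : {linear T j.+2 -> T j.+2}).
  move=> v; apply: fdiff_lift; have := sE (D j.+1 v); rewrite fdiff_comp linear0 addr0 => e.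
  rewrite linearB [D j.+1 ((idfun \- _) v)]linearB.
  have -> : D j.+1 ((b2 \o a2) v) = b1 (a1 (D j.+1 v)) by rewrite bE a2E.
  by rewrite {1}[D j.+1 (idfun v)]e [b1 _ + _]addrC addrK subrr.
exists a1, a2, b2, b3, s1, s2; split=> // v.
by rewrite s2E /= -addrA [s1 _ + _]addrC subrK addrC subrK.
Qed.

End Homotopy.

(** The vanishing of Ext, witnessed on an arbitrary projective resolution, holds on
    any resolution by finite free modules. *)
Lemma Ext_zero_free V N (F : free_resolution V) j : Ext_zero j.+1 V N ->
  forall g : {linear 'rV[R]_(fdim F j.+1) -> N},
    (forall v, g (v *m fmat F j.+1) = 0) ->
    exists h : {linear 'rV[R]_(fdim F j) -> N}, forall v, g v = h (v *m fmat F j).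
Proof.
move=> [P PN] g g0.
have [a0 [a1 [b1 [b2 [s0 [s1 [aE bE sE]]]]]]] := comparison F P j.
have [|h hE] := PN (g \o b1 : {linear _ -> N}).
  by move=> p; rewrite /= -bE g0.
exists ((h \o a0) \+ (g \o s0) : {linear _ -> N}) => v.
rewrite {1}(sE v) !linearD [g (mulmxr _ _)]g0 addr0 /=; congr (_ + _).
by have /= -> := hE (a1 v); rewrite aE.
Qed.

(** A matrix is von Neumann regular when the map it defines splits, that is, when
    its kernel and image are direct summands. *)
Definition mx_regular m n (A : 'M[R]_(m, n)) : Prop := exists S, A = A *m S *m A.

(** In a free resolution of a module of finite projective dimension the
    differentials split in high degrees. *)
Lemma finite_pd_regular V (F : free_resolution V) : finite_pd V ->
  exists d, forall j, (d <= j)%N -> mx_regular (fmat F j).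
Proof.
move=> [P [d Pd]]; exists d => j ledj.
have [a0 [a1 [b1 [b2 [s0 [s1 [_ _ sE]]]]]]] := comparison F P j.
have [S SE] := rV_linear_mx s0; exists S.
apply/eqP; rewrite -subr_eq0; apply/eqP/row_eq0 => v.
rewrite mulmxBr !mulmxA -SE -mulmxBl.
have := sE v; rewrite (Pd _ _ (a1 v)) // linear0 add0r /= => e.
by rewrite {1}e [s0 _ + _]addrC addrK -mulmxA fmatM mulmx0.
Qed.

(** Splitting descends along a complex whose dual is exact. *)
Lemma mx_regular_descent l m n (B : 'M[R]_(l, m)) (A : 'M[R]_(m, n)) :
  B *m A = 0 -> (forall u : 'cV_m, B *m u = 0 -> exists w, u = A *m w) ->
  mx_regular B -> mx_regular A.
Proof.
move=> BA dual [S BS].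
pose U := 1%:M - S *m B.
have BU : B *m U = 0 by rewrite mulmxBr mulmx1 mulmxA -BS subrr.
have /choice [w wE] (j : 'I_m) : exists w, col j U = A *m w.
  by apply: dual; rewrite colE mulmxA BU mul0mx.
exists (\matrix_(i, j) w j i 0).
have -> : A *m (\matrix_(i, j) w j i 0) = U.
  apply/matrixP => i j; have /colP /(_ i) := wE j; rewrite [LHS]mxE => ->.
  by rewrite !mxE; apply: eq_bigr => l' _; rewrite mxE.
by rewrite mulmxBl mul1mx -mulmxA BA mulmx0 subr0.
Qed.

Lemma mx_regular_tr m n (A : 'M[R]_(m, n)) : mx_regular A^T -> mx_regular A.
Proof.
by move=> [S e]; exists S^T; rewrite -[LHS]trmxK e !trmx_mul trmxK mulmxA.
Qed.

Lemma projective_finite_pd V : projective V -> finite_pd V.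
Proof.
move=> pV.
pose T j : lmodType R := if j is 0 then V else 'rV[R]_0.
pose dT j : {linear T j.+1 -> T j} := \0.
have T0 j (v : T j.+1) : v = 0 by apply/rowP => -[].
have ex0 : exact (dT 0%N) (idfun : {linear V -> V}).
  move=> v; split=> [e|[_ <-]] //; exists 0.
  by rewrite -[v]/(idfun v) e.
have exT j : exact (dT j.+1) (dT j).
  by move=> v; split=> // _; exists 0; rewrite [RHS]T0.
have pT j : projective (T j) by case: j => [|j] //; apply: rV_projective.
have idS : surj (idfun : {linear V -> V}) by move=> v; exists v.
by exists (ProjResolution pT idS ex0 exT), 0%N => -[|j].
Qed.

Lemma ses_finite_pd (K : lmodType R) P V (i : {linear K -> P}) (p : {linear P -> V}) :
  ses i p -> projective P -> finite_pd K -> finite_pd V.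
Proof.
move=> [ii ps ip] pP [Q [d Qd]].
pose T j : lmodType R := if j is j'.+1 then pterm Q j' else P.
pose dT j : {linear T j.+1 -> T j} :=
  match j return {linear T j.+1 -> T j} with
  | 0 => (i \o paug Q : {linear _ -> P})
  | j'.+1 => pdiff Q j'
  end.
have pT j : projective (T j) by case: j => [|j] //; apply: pterm_projective.
have ex0 : exact (dT 0%N) p.
  move=> v; rewrite ip; split=> [[x <-]|[y <-]]; last by exists (paug Q y).
  by have [y <-] := paug_surj Q x; exists y.
have exT j : exact (dT j.+1) (dT j).
  case: j => [|j]; last exact: (@pdiff_exact _ _ Q j).
  move=> v; split=> [e|/(@paug_exact _ _ Q) e]; last by rewrite /= e linear0.
  by apply/(@paug_exact _ _ Q)/ii; rewrite linear0.
by exists (ProjResolution pT ps ex0 exT), d.+1 => -[|j] //=; apply: Qd.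
Qed.

(** If some differential splits, the corresponding syzygy is projective. *)
Lemma regular_finite_pd V (F : free_resolution V) j : mx_regular (fmat F j) -> finite_pd V.
Proof.
elim: j V F => [|j IH] V F.
  move=> [S DS]; apply: projective_finite_pd => A B f g fs.
  have [h hE] := rV_projective (g \o faug F : {linear _ -> B}) fs.
  have [|h' h'E] := @factor_surj _ _ _ _ (faug F)
      (h \o (idfun \- (mulmxr (S *m fmat F 0))) : {linear _ -> A}) (@faug_surj _ _ F).
    by move=> _ /faug_exact [w ->] /=; rewrite mulmxA -[_ *m S]mulmxA -mulmxA -DS subrr linear0.
  exists h' => v; have [u <-] := faug_surj F v; rewrite h'E /= hE /= linearB.
  have -> : faug F (u *m (S *m fmat F 0)) = 0 by apply/faug_exact; exists (u *m S); rewrite mulmxA.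
  by rewrite subr0.
have [K [i [q [qs [qk [iF iq]]]]]] := first_syzygy F.
move=> reg; apply: (ses_finite_pd iF); first exact: rV_projective.
exact: (IH K (shift_resolution qs qk)).
Qed.

End Comparison.

(** * Tor of the transpose of a syzygy *)

Section Tor.
Variables (R : comNzRingType) (N : lmodType R).

(** The tensor product of R^m with N is N^m, and that of a matrix with N is the
    action of the matrix on tuples of elements of N. *)
Definition mxact m n (A : 'M[R]_(m, n)) (u : {ffun 'I_m -> N}) : {ffun 'I_n -> N} :=
  [ffun j => \sum_i A i j *: u i].

Lemma mxact_is_linear m n (A : 'M[R]_(m, n)) : linear (mxact A).
Proof.
move=> a u v; apply/ffunP => j; rewrite !ffunE scaler_sumr -big_split /=.
by apply: eq_bigr => i _; rewrite !ffunE scalerDr !scalerA mulrC.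
Qed.

Lemma mxactM m n p (A : 'M[R]_(m, n)) (B : 'M[R]_(n, p)) u :
  mxact B (mxact A u) = mxact (A *m B) u.
Proof.
apply/ffunP => k; rewrite !ffunE.
under eq_bigr do rewrite ffunE scaler_sumr.
rewrite exchange_big /=; apply: eq_bigr => i _.
rewrite mxE scaler_suml; apply: eq_bigr => j _.
by rewrite scalerA mulrC.
Qed.

Lemma mxact0 m n (u : {ffun 'I_m -> N}) : mxact (0 : 'M[R]_(m, n)) u = 0.
Proof. by apply/ffunP => k; rewrite !ffunE big1 // => i _; rewrite mxE scale0r. Qed.

(** The pure tensors of R^m and N, as tuples of elements of N. *)
Definition row_tensor m (p : 'rV[R]_m) (y : N) : {ffun 'I_m -> N} :=
  [ffun i => p 0 i *: y].

Lemma row_tensor_bilinear m :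
  bilinear_for (GRing.Scale.Law.clone _ _ *:%R _) (GRing.Scale.Law.clone _ _ *:%R _)
    (@row_tensor m : 'rV[R]_m -> N -> {ffun 'I_m -> N}).
Proof.
split=> [y|p] a u v; apply/ffunP => i; rewrite !ffunE ?mxE.
  by rewrite scalerDl scalerA.
by rewrite scalerDr !scalerA mulrC.
Qed.

Definition row_tensor_map m : {bilinear 'rV[R]_m -> N -> {ffun 'I_m -> N}} :=
  HB.pack (@row_tensor m) (bilinear_isBilinear.Build R _ _ _ _ _ (@row_tensor m)
    (@row_tensor_bilinear m)).

Lemma row_tensorP m : is_tensor (row_tensor_map m).
Proof.
move=> C f; split=> [|g h gf hf u].
  have gl : linear (fun u : {ffun 'I_m -> N} => \sum_i f (delta_mx 0 i) (u i)).
    move=> a u v; rewrite scaler_sumr -big_split /=; apply: eq_bigr => i _.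
    by rewrite !ffunE linearDr linearZr_LR.
  exists (linmap gl) => p y /=; rewrite [in RHS](row_sum_delta p) linear_sumlz.
  by apply: eq_bigr => i _; rewrite ffunE linearZr_LR linearZl_LR.
have -> : u = \sum_i row_tensor_map m (delta_mx 0 i) (u i).
  apply/ffunP => i; rewrite sum_ffunE (bigD1 i) //= ffunE mxE !eqxx scale1r.
  by rewrite big1 ?addr0 // => j ne; rewrite ffunE mxE eqxx eq_sym (negbTE ne) scale0r.
by rewrite !linear_sum; apply: eq_bigr => i _; rewrite gf hf.
Qed.

Lemma Tor_zero_free V (G : free_resolution V) j :
  (forall u : {ffun 'I_(fdim G j.+1) -> N}, mxact (fmat G j) u = 0 ->
     exists w, mxact (fmat G j.+1) w = u) ->
  Tor_zero j.+1 V N.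
Proof.
move=> ex.
pose d i : {linear 'rV[R]_(fdim G i.+1) -> 'rV[R]_(fdim G i)} := mulmxr (fmat G i).
have ex0 : exact (d 0%N) (faug G).
  by move=> v; rewrite faug_exact; split=> -[w e]; exists w.
have exd i : exact (d i.+1) (d i).
  by move=> v; rewrite /= fmat_exact; split=> -[w e]; exists w.
exists (ProjResolution (fun i => @rV_projective R (fdim G i)) (@faug_surj _ _ G) ex0 exd).
exists (fun i => {ffun 'I_(fdim G i) -> N} : lmodType R).
exists (fun i => row_tensor_map (fdim G i)), (fun i => linmap (mxact_is_linear (fmat G i))).
split=> [i|i p y|u]; first exact: row_tensorP.
  apply/ffunP => k; rewrite !ffunE mxE scaler_suml; apply: eq_bigr => l _.
  by rewrite ffunE scalerA mulrC.
split=> [/ex [w e]|[w <-]]; first by exists w.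
by rewrite /= mxactM fmatM mxact0.
Qed.

End Tor.

Section Main.
Variable R : comNzRingType.

(** As the dual of F is exact above degree n + 1, the kernel of q is the row space of
    the transpose of [fmat F j], so K is the transpose of a syzygy of M.  It embeds in
    a free module with a cokernel of the same kind, which raises the degree of Ext
    until it exceeds n + 1. *)
Lemma Ext_vanishes_transpose (J : inj_resolution (R^o : lmodType R)) n (M : lmodType R)
    (F : free_resolution M) :
  finitely_generated M -> (forall e, (n < e)%N -> Ext_fg J e) ->
  forall j e, (n < j)%N -> forall (K : lmodType R) (q : {linear 'rV[R]_(fdim F j.+1) -> K}),
    surj q -> (forall v, q v = 0 <-> v *m (fmat F j.+1)^T = 0) -> Ext_vanishes J e K.
Proof.
move=> fgM van.
have dual j : (n < j)%N -> forall v : 'rV[R]_(fdim F j.+1),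
    v *m (fmat F j.+1)^T = 0 -> exists w, v = w *m (fmat F j)^T.
  move=> ltj v v0; have [|w e] := Ext_vanishes_dual (van j ltj M fgM) (F := F) (u := v^T).
    by rewrite -[LHS]trmxK trmx_mul trmxK v0 trmx0.
  by exists w^T; rewrite -trmx_mul -e trmxK.
suff gen m : forall j e, (n < j)%N -> (n < e + m)%N ->
    forall (K : lmodType R) (q : {linear 'rV[R]_(fdim F j.+1) -> K}),
    surj q -> (forall v, q v = 0 <-> v *m (fmat F j.+1)^T = 0) -> Ext_vanishes J e K.
  by move=> j e ltj; apply: (gen n.+1) => //; rewrite addnS ltnS leq_addl.
elim: m => [|m IH] j e ltj lte K q qs qk.
  by apply: van; [rewrite -[e]addn0 | apply: (fg_surj qs); apply: fg_rV].
have [K' [q' [i' [qs' ii iq]]]] :=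
  image_exists (mulmxr (fmat F j.+2)^T : {linear 'rV_(fdim F j.+2) -> 'rV_(fdim F j.+3)}).
have qk' v : q' v = 0 <-> v *m (fmat F j.+2)^T = 0.
  by move: (iq v) => /= <-; split=> [->|e0]; [rewrite linear0 | apply: ii; rewrite e0 linear0].
have [|i iE] := @factor_surj _ _ _ _ q
    (mulmxr (fmat F j.+1)^T : {linear 'rV_(fdim F j.+1) -> 'rV_(fdim F j.+2)}) qs.
  by move=> v /qk.
apply: (@Ext_vanishes_sub _ _ _ _ _ _ i q'); last first.
- by apply: (IH j.+1 e.+1) qs' qk'; [apply: ltnW | rewrite addSnnS].
- exact: Ext_vanishes_rV.
split=> // [u v|v].
  have [a <-] := qs u; have [b <-] := qs v; rewrite !iE /= => e0.
  by apply/eqP; rewrite -subr_eq0 -linearB; apply/eqP/qk; rewrite mulmxBl e0 subrr.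
split=> [/qk' /(dual j.+1 (ltnW ltj)) [w ->]|[x <-]]; first by exists (q w); rewrite iE.
have [w <-] := qs x; apply/qk'.
by rewrite iE /= -mulmxA -trmx_mul fmatM trmx0 mulmx0.
Qed.

(** If R has injective dimension at most n + 1, then one vanishing Ext of M with
    values in a rigid-test module, in degree t + 1 > n, gives pd M finite.  In the
    proof, X is the transpose of the syzygy of order t + 1 of M. *)
Lemma rigid_test_finite_pd (J : inj_resolution (R^o : lmodType R)) n
    (M N : lmodType R) t :
  noetherian R -> (forall e, (n < e)%N -> Ext_fg J e) ->
  finitely_generated M -> rigid_test N -> (n <= t)%N -> Ext_zero t.+1 M N -> finite_pd M.
Proof.
move=> noeth van fgM rigid lent ext; have [F] := fg_resolution noeth fgM.
have ltnt : (n < t.+1)%N by [].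
have [X [q [iX [qs ii iq]]]] :=
  image_exists (mulmxr (fmat F t.+2)^T : {linear 'rV_(fdim F t.+2) -> 'rV_(fdim F t.+3)}).
have qk v : q v = 0 <-> v *m (fmat F t.+2)^T = 0.
  by move: (iq v) => /= <-; split=> [->|e0]; [rewrite linear0 | apply: ii; rewrite e0 linear0].
have qA v : q v = 0 <-> exists w, v = w *m (fmat F t.+1)^T.
  rewrite qk; split=> [v0|[w ->]]; last by rewrite -mulmxA -trmx_mul fmatM trmx0 mulmx0.
  have [|w e] := Ext_vanishes_dual (van t.+1 ltnt M fgM) (F := F) (u := v^T).
    by rewrite -[LHS]trmxK trmx_mul trmxK v0 trmx0.
  by exists w^T; rewrite -trmx_mul -e trmxK.
have fgX : finitely_generated X := fg_surj qs (@fg_rV R _).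
have vanX e : Ext_vanishes J e X := Ext_vanishes_transpose fgM van ltnt qs qk.
pose G := presentation_resolution noeth qs qA.
have tor : Tor_zero 1 X N.
  apply: (Tor_zero_free (G := G)) => u u0.
  have gl : linear (fun v : 'rV[R]_(fdim F t.+1) => \sum_i v 0 i *: u i).
    move=> a v w; rewrite scaler_sumr -big_split /=; apply: eq_bigr => i _.
    by rewrite !mxE scalerDl scalerA.
  have [|h hE] := Ext_zero_free (F := F) ext (g := linmap gl).
    move=> v; rewrite [v]row_sum_delta mulmx_suml linear_sum big1 // => k _.
    rewrite -scalemxAl linearZ /= -rowE -[RHS](scaler0 _ (v 0 k)); congr (_ *: _).
    have /ffunP /(_ k) := u0; rewrite !ffunE => u0k.
    by rewrite -[RHS]u0k /=; apply: eq_bigr => i _; rewrite !mxE.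
  pose z : {ffun 'I_(fdim F t) -> N} := [ffun l => h (delta_mx 0 l)].
  have uE : u = mxact (fmat F t)^T z.
    apply/ffunP => i; rewrite ffunE.
    have := hE (delta_mx 0 i); rewrite /= -rowE [row _ _]row_sum_delta linear_sum.
    rewrite (bigD1 i) //= mxE !eqxx scale1r big1 ?addr0 => [->|j ne]; last first.
      by rewrite mxE eqxx (negbTE ne) scale0r.
    by apply: eq_bigr => l _; rewrite linearZ /= !mxE ffunE.
  have /choice [c cE] (l : 'I_(fdim F t)) : exists c, row l (fmat F t)^T = c *m fmat G 1.
    apply/(@fmat_exact _ _ G 0); rewrite -row_mul.
    by rewrite -[fmat G 0]/((fmat F t.+1)^T) -trmx_mul fmatM trmx0 row0.
  (* The transposed differential factors through the second differential of G. *)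
  exists (mxact (\matrix_l c l) z); rewrite mxactM uE; congr (mxact _ _).
  by apply/row_matrixP => l; rewrite row_mul rowK cE.
have [_ /(finite_pd_regular G) [d reg]] := rigid X fgX 1%N isT tor.
apply: (regular_finite_pd (F := F) (j := t.+1)); apply: mx_regular_tr.
rewrite -[(fmat F t.+1)^T]/(fmat G 0).
(* The splitting descends from degree d to degree 0, as Ext(X, R) = 0. *)
elim: d reg => [|d IH] reg; first exact: (reg 0%N isT).
apply: IH => j; rewrite leq_eqVlt => /orP [/eqP <-|]; last exact: reg.
apply: (mx_regular_descent (fmatM G d)); last exact/reg/leqnn.
exact: Ext_vanishes_dual.
Qed.

End Main.

Theorem corollary3p23 (R : comNzRingType) (n : nat) (x : n.-tuple R^o)
    (M N : lmodType R) (t : nat) :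
  gorenstein R ->
  quasi_fiber_product_ring x ->
  finitely_generated M -> nonzero_module M ->
  finitely_generated N -> nonzero_module N ->
  rigid_test N ->
  (n < t)%N ->
  (forall i, (t <= i <= t + n)%N -> Ext_zero i M N) ->
  finite_pd M \/ regular_ring R.
Proof.
move=> gor qfp fgM _ _ _ rigid ltnt ext; left.
have [J van] := gorenstein_Ext_vanishes gor qfp.
case: t ltnt ext => [|t] // ltnt ext.
have [[noeth _] _] := gor.
apply: (rigid_test_finite_pd noeth van fgM rigid (t := t)).
  by rewrite size_tuple.
by apply: ext; rewrite leqnn leq_addr.
Qed.
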